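(* Suppose Assumptions (A1)–(A3) hold, $\bar g=\nabla l$ for a convex differentiable function $l:\mathbb R^d\to\mathbb R$, and $\theta^*\in\mathcal C$ minimizes $l$. Let the step sizes $\eta_t>0$ be nonincreasing, and let $\theta_t$ follow $\theta_{t+1}=\mathbf P_{\mathcal C}(\theta_t-\eta_t\hat g_t(\theta_t,z_t))$ with $\theta_0\in\mathcal C$, and $\bar\theta_T=\frac1T\sum_{t=1}^T\theta_t$. Then there is a constant $K$ depending only (polynomially) on $C_0,C_1,G$ such that for all $T\ge 2$ $$\mathbb E\, l(\bar\theta_T)-l(\theta^* )\le \frac{K}{T}\Big(\tau\log T\sum_{t=0}^{T}\eta_t+\frac1{\eta_T}+\sum_{t=0}^T\mathbb E e_t\Big).$$ In particular, if $\eta_t=\eta_0t^{-1/2}$ for some $\eta_0>0$, $\tau=O(1)$ and $\mathbb E e_t=O(1/\sqrt t)$, then $\mathbb E\, l(\bar\theta_T)-l(\theta^* )=O(\log T/\sqrt T)$.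
   Context: $(z_t)_{t\ge0}$ is a random data sequence in a space $\mathcal Z$, $\mathcal C\subset\mathbb R^d$ is closed convex, $\mathbf P_{\mathcal C}(\theta)=\arg\min_{\theta'\in\mathcal C}\|\theta-\theta'\|$ is the Euclidean projection, and $\hat g_t(\theta,z)\in\mathbb R^d$ are (possibly random, data-dependent) update directions. (A1) $z_t$ is an ergodic Markov chain on $\mathcal Z$ with stationary distribution $\mu$ and finite mixing time $\tau$, i.e. $\|P(z_\tau\in\cdot\,|z_0)-\mu\|_{TV}\le1/4$ for every $z_0$. (A2) There is a function $g(\theta,z)$ with $\bar g(\theta):=\int g(\theta,z)\,\mu(dz)$, and random variables $e_t$ with $\mathbb E e_t^2<\infty$ such that $\|g(\theta_t,z_t)-\hat g_t(\theta_t,z_t)\|\le e_t$. (A3) $\theta^*\in\mathcal C$; there are $C_0,C_1>0$ with $\|\bar g\|_\infty,\|\hat g_t\|_\infty,\|g\|_\infty\le C_0$ and $\mathcal C\subset\{\theta:\|\theta\|\le C_1\}$; there is $G>0$ such that $\theta\mapsto g(\theta,z)$ is $G$-Lipschitz on $\mathcal C$ for every $z$.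
   Formalization: The update directions are assumed non-anticipating: each iterate is measurable for a filtration with respect to which the data chain is Markov. The mixing time is taken at least 1, and in the last part the step size at t=0 is set to the constant, since t^{-1/2} is undefined there. *)

(* Defs.v *)
From HB Require Import structures.
From mathcomp Require Import all_boot all_order all_algebra.
From mathcomp Require Import all_classical all_reals all_analysis measurable_realfun.
Set Implicit Arguments. Unset Strict Implicit. Unset Printing Implicit Defensive.
Import Order.TTheory GRing.Theory Num.Theory.
Import numFieldNormedType.Exports.
Local Open Scope classical_set_scope.
Local Open Scope ring_scope.

Section Defs.
Variables (R : realType) (d : nat).
Notation vec := 'rV[R]_d.

Definition dotv (u v : vec) : R := \sum_(i < d) u ord0 i * v ord0 i.
Definition enorm (v : vec) : R := Num.sqrt (dotv v v).

Definition convex_set (C : set vec) : Prop :=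
  forall x y (lam : R), C x -> C y -> 0 <= lam <= 1 ->
    C (lam *: x + (1 - lam) *: y).

Definition convex_fun (l : vec -> R) : Prop :=
  forall x y (lam : R), 0 <= lam <= 1 ->
    l (lam *: x + (1 - lam) *: y) <= lam * l x + (1 - lam) * l y.

Definition is_projection (C : set vec) (p : vec -> vec) : Prop :=
  forall x, C (p x) /\ forall y, C y -> enorm (x - p x) <= enorm (x - y).

Definition gradient_of (l : vec -> R) (gb : vec -> vec) : Prop :=
  forall x, differentiable l x /\ forall v, 'd l x v = dotv (gb x) v.
End Defs.

Section Prob.
Context (R : realType) (dO dZ : measure_display)
        (Omega : measurableType dO) (Z : measurableType dZ).

Fixpoint kiter (Q : Z -> probability Z R) (n : nat) (x : Z) (A : set Z) : \bar R :=
  match n with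
  | 0 => \d_ x A
  | n'.+1 => (\int[Q x]_y kiter Q n' y A)%E
  end.

Definition filtration (F : nat -> set (set Omega)) : Prop :=
  forall t, sigma_algebra setT (F t) /\ F t `<=` measurable /\ F t `<=` F t.+1.

(** z is F-adapted and a time-homogeneous Markov chain w.r.t. F with
    transition kernel Q:  P(z_{t+1} \in A | F_t) = Q(z_t, A). *)
Definition markov_chain (P : probability Omega R) (F : nat -> set (set Omega))
  (z : nat -> Omega -> Z) (Q : Z -> probability Z R) : Prop :=
  (forall A, measurable A -> measurable_fun [set: Z] (fun x : Z => (Q x A : \bar R))) /\
  (forall t A, measurable A -> F t (z t @^-1` A)) /\
  (forall t A B, measurable A -> F t B ->
     P (B `&` z t.+1 @^-1` A) = (\int[P]_(w in B) Q (z t w) A)%E).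

Definition stationary (Q : Z -> probability Z R) (mu : probability Z R) : Prop :=
  forall A, measurable A -> mu A = (\int[mu]_x Q x A)%E.

(** total-variation distance between Q^tau(z0, .) and mu is at most 1/4,
    for every starting point z0 (TV = sup over measurable sets). *)
Definition mixing_time_bound (Q : Z -> probability Z R) (mu : probability Z R)
  (tau : nat) : Prop :=
  forall z0 A, measurable A -> (`| kiter Q tau z0 A - mu A | <= (4%:R^-1)%:E)%E.

Definition expect (P : probability Omega R) (X : Omega -> R) : \bar R :=
  (\int[P]_w (X w)%:E)%E.
End Prob.

Section Setting.
Context (R : realType) (d : nat) (dO dZ : measure_display)
        (Omega : measurableType dO) (Z : measurableType dZ).
Notation vec := 'rV[R]_d.

Definition psgd_setting
  (P : probability Omega R) (F : nat -> set (set Omega))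
  (z : nat -> Omega -> Z) (Q : Z -> probability Z R) (mu : probability Z R)
  (tau : nat)
  (g : vec -> Z -> vec) (ghat : nat -> Omega -> vec -> Z -> vec)
  (e : nat -> Omega -> R)
  (C : set vec) (proj : vec -> vec) (C0 C1 G : R)
  (l : vec -> R) (thstar : vec) (eta : nat -> R) (theta : nat -> Omega -> vec)
  : Prop :=
  let gbar := fun th : vec => \row_(i < d) (\int[mu]_x (g th x) ord0 i)%R in
  filtration F /\ markov_chain P F z Q /\ stationary Q mu /\
  (1 <= tau)%N /\ mixing_time_bound Q mu tau /\
  (forall th i, measurable_fun setT (fun x => (g th x) ord0 i)) /\
  (forall t, measurable_fun setT (e t)) /\
  (forall t, (\int[P]_w ((e t w) ^+ 2)%:E < +oo)%E) /\
  (forall t w, enorm (g (theta t w) (z t w) - ghat t w (theta t w) (z t w))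
               <= e t w) /\
  closed C /\ convex_set C /\ is_projection C proj /\ C thstar /\
  0 < C0 /\ 0 < C1 /\ 0 < G /\
  (forall th, enorm (gbar th) <= C0) /\
  (forall t w th x, enorm (ghat t w th x) <= C0) /\
  (forall th x, enorm (g th x) <= C0) /\
  (forall th, C th -> enorm th <= C1) /\
  (forall x th th', C th -> C th' ->
     enorm (g th x - g th' x) <= G * enorm (th - th')) /\
  convex_fun l /\ gradient_of l gbar /\ (forall th, C th -> l thstar <= l th) /\
  (forall t, 0 < eta t) /\ (forall t, eta t.+1 <= eta t) /\
  (forall w, C (theta 0%N w)) /\
  (forall t w, theta t.+1 w =
       proj (theta t w - eta t *: ghat t w (theta t w) (z t w))) /\
  (forall t i B, measurable B -> F t ((fun w => (theta t w) ord0 i) @^-1` B)).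

Definition avg_iter (theta : nat -> Omega -> vec) (T : nat) (w : Omega) : vec :=
  (T%:R)^-1 *: \sum_(1 <= t < T.+1) theta t w.
End Setting.

(* Main.v *)
Require Import Defs.
From HB Require Import structures.
From mathcomp Require Import all_boot all_order all_algebra.
From mathcomp Require Import all_classical all_reals all_analysis measurable_realfun.
From mathcomp Require Import ring lra zify.
Import Order.TTheory GRing.Theory Num.Theory.
Import numFieldNormedType.Exports.
Local Open Scope classical_set_scope.
Local Open Scope ring_scope.

(** Projection is non-expansive towards points of [C], so
    [<ghat_t, theta_t - theta*>] is a telescoping difference of squared
    distances over [2 eta_t] plus [eta_t C0^2 / 2]; by convexity the loss gap is
    bounded by this quantity, by [2 C1 e_t], and by the gradient noise
    [<gbar theta_t - g(theta_t, z_t), theta_t - theta*>].  The noise is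
    Lipschitz in [theta] and [theta_t] moves by at most [C0 h eta_(t-h)] in
    [h = k tau] steps, so [theta_t] may be frozen at time [t - h]; given the
    past at that time, the chain has forgotten its state up to [2^-k], because
    the kernel iterated [tau] times halves the oscillation of every bounded
    function.  Taking [2^k >= T] gives the logarithm; the first [h] steps are
    bounded trivially and absorbed since
    [min (a, T) <= a T eta_T + 1 / eta_T]. *)

(** * Euclidean geometry: inner product, projection onto a convex set, gradient inequality *)

Section Euclid.
Set Implicit Arguments. Unset Strict Implicit. Unset Printing Implicit Defensive.
Context (R : realType) (d : nat).
Implicit Types (u v w : 'rV[R]_d) (C : set 'rV[R]_d).

Lemma dotvC u v : dotv u v = dotv v u.
Proof. by apply: eq_bigr => i _; rewrite mulrC. Qed.

Lemma dotvDl u v w : dotv (u + v) w = dotv u w + dotv v w.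
Proof. by rewrite /dotv -big_split; apply: eq_bigr => i _; rewrite !mxE mulrDl. Qed.

Lemma dotvZl a u v : dotv (a *: u) v = a * dotv u v.
Proof. by rewrite /dotv mulr_sumr; apply: eq_bigr => i _; rewrite !mxE mulrA. Qed.

Lemma dotvNl u v : dotv (- u) v = - dotv u v.
Proof. by rewrite -scaleN1r dotvZl mulN1r. Qed.

Lemma dotvDr u v w : dotv u (v + w) = dotv u v + dotv u w.
Proof. by rewrite dotvC dotvDl ![dotv _ u]dotvC. Qed.

Lemma dotvZr a u v : dotv u (a *: v) = a * dotv u v.
Proof. by rewrite dotvC dotvZl dotvC. Qed.

Lemma dotvNr u v : dotv u (- v) = - dotv u v.
Proof. by rewrite dotvC dotvNl dotvC. Qed.

Definition dotvE := (dotvDl, dotvDr, dotvNl, dotvNr, dotvZl, dotvZr).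

Lemma dotv_sumr (I : Type) (r : seq I) (P : pred I) u (F : I -> 'rV[R]_d) :
  dotv u (\sum_(i <- r | P i) F i) = \sum_(i <- r | P i) dotv u (F i).
Proof.
apply: (big_morph (dotv u)) => [x y|]; first exact: dotvDr.
by rewrite -(scale0r (0 : 'rV[R]_d)) dotvZr mul0r.
Qed.

Lemma dotv_ge0 u : 0 <= dotv u u.
Proof. by apply: sumr_ge0 => i _; rewrite -expr2 sqr_ge0. Qed.

Lemma enorm_ge0 u : 0 <= enorm u.
Proof. exact: sqrtr_ge0. Qed.

Lemma sqr_enorm u : enorm u ^+ 2 = dotv u u.
Proof. by rewrite sqr_sqrtr // dotv_ge0. Qed.

Lemma dotv0l u : dotv 0 u = 0.
Proof. by rewrite -(scale0r 0) dotvZl mul0r. Qed.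

Lemma enorm0_eq0 u : enorm u = 0 -> u = 0.
Proof.
move=> u0; have : dotv u u = 0 by rewrite -sqr_enorm u0 expr0n.
move/psumr_eq0P => h; apply/rowP => i; rewrite mxE.
have /eqP : u ord0 i * u ord0 i = 0.
  by apply: h => // j _; rewrite -expr2 sqr_ge0.
by rewrite mulf_eq0 orbb => /eqP.
Qed.

(** Cauchy-Schwarz: the square of [enorm v *: u - enorm u *: v] is [2 * enorm u * enorm v] times the
    wanted difference, so vectors of norm zero are treated apart. *)
Lemma dotv_le_enorm u v : dotv u v <= enorm u * enorm v.
Proof.
have [/enorm0_eq0 ->|u0] := eqVneq (enorm u) 0.
  by rewrite dotv0l mulr_ge0 ?enorm_ge0.
have [/enorm0_eq0 ->|v0] := eqVneq (enorm v) 0.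
  by rewrite dotvC dotv0l mulr_ge0 ?enorm_ge0.
have up : 0 < enorm u by rewrite lt_neqAle eq_sym u0 enorm_ge0.
have vp : 0 < enorm v by rewrite lt_neqAle eq_sym v0 enorm_ge0.
have := dotv_ge0 (enorm v *: u - enorm u *: v).
rewrite !dotvE (dotvC v u) -!sqr_enorm => h.
have : 0 <= 2 * (enorm u * enorm v) * (enorm u * enorm v - dotv u v) by lra.
by rewrite pmulr_rge0 ?subr_ge0 // !mulr_gt0.
Qed.

Lemma enormN u : enorm (- u) = enorm u.
Proof. by rewrite /enorm !dotvE opprK. Qed.

Lemma enormBC u v : enorm (u - v) = enorm (v - u).
Proof. by rewrite -enormN opprB. Qed.

Lemma enormZ a u : 0 <= a -> enorm (a *: u) = a * enorm u.
Proof.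
by move=> a0; rewrite /enorm !dotvE mulrA -expr2 sqrtrM ?sqr_ge0// sqrtr_sqr ger0_norm.
Qed.

Lemma enorm_le_sqr u v : dotv u u <= dotv v v -> enorm u <= enorm v.
Proof. by move=> h; rewrite /enorm ler_wsqrtr. Qed.

Lemma enormD u v : enorm (u + v) <= enorm u + enorm v.
Proof.
rewrite -(@ler_pXn2r _ 2) ?nnegrE ?addr_ge0 ?enorm_ge0//.
rewrite sqr_enorm !dotvE (dotvC v u) sqrrD !sqr_enorm.
have := dotv_le_enorm u v; lra.
Qed.

Lemma enormB_le u v w : enorm (u - w) <= enorm (u - v) + enorm (v - w).
Proof. by have := enormD (u - v) (v - w); rewrite addrA subrK. Qed.

Lemma norm_dotv_le u v : `|dotv u v| <= enorm u * enorm v.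
Proof.
rewrite ler_norml dotv_le_enorm andbT lerNl -dotvNl.
by rewrite (le_trans (dotv_le_enorm _ _))// enormN.
Qed.

Lemma entry_le_enorm u i : `|u ord0 i| <= enorm u.
Proof.
rewrite -sqrtr_sqr ler_wsqrtr // /dotv (bigD1 i) //= -expr2 lerDl.
by apply: sumr_ge0 => j _; rewrite -expr2 sqr_ge0.
Qed.

(** The factor [d] in place of its square root is harmless: the bound only serves to choose a mesh
    size, so the dimension does not reach the final rate. *)
Lemma enorm_le_entries u (a : R) : 0 <= a ->
  (forall i, `|u ord0 i| <= a) -> enorm u <= d%:R * a.
Proof.
move=> a0 ua.
have : dotv u u <= (d%:R * a) ^+ 2.
  apply: (@le_trans _ _ (d%:R * a ^+ 2)).
    rewrite mulr_natl -[X in _ *+ X]card_ord -sumr_const.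
    apply: ler_sum => i _.
    by rewrite -expr2 -real_normK ?num_real// ler_pXn2r ?nnegrE.
  rewrite exprMn ler_wpM2r ?sqr_ge0// -natrX ler_nat.
  by case: (d) => // n; rewrite -mulnn leq_pmulr.
move=> h; rewrite -(@ler_pXn2r _ 2) ?nnegrE ?mulr_ge0 ?enorm_ge0//.
by rewrite sqr_enorm.
Qed.

(** If the angle at [p x] were acute, a short move from [p x] towards [c] would stay in [C] and come
    strictly closer to [x]. *)
Lemma projection_obtuse C p x c : Defs.convex_set C -> is_projection C p -> C c ->
  dotv (x - p x) (c - p x) <= 0.
Proof.
move=> cC pC Cc; have [Cp pmin] := pC x.
set a := x - p x; set b := c - p x.
rewrite leNgt; apply/negP => ab0.
(* This step length gives [lam * dotv b b < dotv a b], short enough for a strict decrease; the [1 +]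
   keeps the denominator positive. *)
pose lam := Num.min 1 (dotv a b / (1 + dotv b b)).
have bb : 0 <= dotv b b := dotv_ge0 b.
have q0 : 0 < dotv a b / (1 + dotv b b) by rewrite divr_gt0 // ltr_wpDr.
have l0 : 0 < lam by rewrite lt_min ltr01.
have l1 : lam <= 1 by rewrite ge_min lexx.
have := pmin _ (cC _ _ lam Cc Cp _); rewrite (ltW l0) l1 => /(_ isT).
have -> : x - (lam *: c + (1 - lam) *: p x) = a - lam *: b.
  by apply/rowP => i; rewrite !mxE; ring.
rewrite -/a; clearbody a b.
rewrite -(@ler_pXn2r _ 2) ?nnegrE ?enorm_ge0// !sqr_enorm !dotvE (dotvC b a) => h.
have lb : lam * (1 + dotv b b) <= dotv a b.
  by rewrite -ler_pdivlMr ?ge_min ?lexx ?orbT// ltr_wpDr.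
have : lam * (2 * dotv a b - lam * dotv b b) <= 0 by lra.
clearbody lam; rewrite pmulr_rle0 // => h2.
have h3 : lam + lam * dotv b b <= dotv a b by rewrite mulrDr mulr1 in lb.
lra.
Qed.

(** In the square of [x - c = (x - p x) + (p x - c)] the cross term is nonnegative by the obtuse
    angle. *)
Lemma projection_dist_le C p x c : Defs.convex_set C -> is_projection C p -> C c ->
  enorm (p x - c) <= enorm (x - c).
Proof.
move=> cC pC Cc; have := projection_obtuse x cC pC Cc.
rewrite -(opprB (p x) c) => h; apply: enorm_le_sqr.
have -> : x - c = (x - p x) + (p x - c) by rewrite addrA subrK.
move: h; move: (x - p x) (p x - c) => a b.
rewrite !dotvE (dotvC b a); have := dotv_ge0 a; lra.
Qed.

(** Convexity bounds the difference quotient from [x] towards [y] by [l y - l x] for every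
    [0 < h <= 1]; the limit from the right is the directional derivative. *)
Lemma convex_gradient_le (l : 'rV[R]_d -> R) gb x y :
  convex_fun l -> gradient_of l gb -> l x + dotv (gb x) (y - x) <= l y.
Proof.
move=> cl gl; have [dl dlE] := gl x.
rewrite -lerBrDl -dlE -deriveE //.
have cv := @diff_derivable _ _ _ _ _ (y - x) dl.
apply: (@cvgr_to_le _ _ _ R _ _ _ (cvg_dnbhs_at_right cv)).
near=> h.
have h0 : 0 < h by near: h; exact: nbhs_right_gt.
have h1 : h <= 1 by near: h; exact: nbhs_right_le.
have := cl y x h; rewrite (ltW h0) h1 => /(_ isT).
have -> : h *: y + (1 - h) *: x = h *: (y - x) + x.
  by apply/rowP => i; rewrite !mxE; ring.
move=> lh; rewrite /= /GRing.scale/= ler_pdivrMl//; lra.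
Unshelve. all: by end_near.
Qed.
End Euclid.

(** * Comparing integral functionals on bounded measurable functions through indicators *)

Section BoundedMeasurable.
Set Implicit Arguments. Unset Strict Implicit. Unset Printing Implicit Defensive.
Context (R : realType) (dT : measure_display) (T : measurableType dT).
Implicit Types (f g : T -> R) (A : set T) (U V : (T -> R) -> R).

Definition bmeas f := measurable_fun setT f /\ exists M : R, forall x, `|f x| <= M.

Lemma bmeas_cst (a : R) : bmeas (cst a).
Proof. by split; [exact: measurable_cst|exists `|a|]. Qed.

Lemma bmeasD f g : bmeas f -> bmeas g -> bmeas (fun x => f x + g x).
Proof.
move=> [mf [M fM]] [mg [N gN]]; split; first exact: measurable_funD.
by exists (M + N) => x; rewrite (le_trans (ler_normD _ _))// lerD.
Qed.

Lemma bmeasM f g : bmeas f -> bmeas g -> bmeas (fun x => f x * g x).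
Proof.
move=> [mf [M fM]] [mg [N gN]]; split; first exact: measurable_funM.
by exists (M * N) => x; rewrite normrM ler_pM.
Qed.

Lemma bmeasZ (a : R) f : bmeas f -> bmeas (fun x => a * f x).
Proof. exact/bmeasM/bmeas_cst. Qed.

Lemma bmeas_sum (I : Type) (r : seq I) (P : pred I) (F : I -> T -> R) :
  (forall i, P i -> bmeas (F i)) -> bmeas (fun x => \sum_(i <- r | P i) F i x).
Proof.
move=> bF; elim: r => [|i r ih].
  under eq_fun do rewrite big_nil; exact: bmeas_cst.
under eq_fun do rewrite big_cons.
case Pi : (P i) => //; by apply: bmeasD => //; exact: bF.
Qed.

Lemma bmeas_indic A : measurable A -> bmeas \1_A.
Proof.
move=> mA; split; first exact: measurable_indic.
by exists 1 => x; rewrite indicE; case: (x \in A); rewrite ?normr1 ?normr0.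
Qed.

Lemma bmeas_integrable (mu : probability T R) f :
  bmeas f -> mu.-integrable setT (EFin \o f).
Proof.
move=> [mf [M fM]]; apply: measurable_bounded_integrable => //.
  by apply: (le_lt_trans (probability_le1 mu measurableT)); rewrite ltry.
exists M; split; rewrite ?num_real// => N MN x _.
by apply: (le_trans (fM x)); exact: ltW.
Qed.

(* The integral against a measure of mass at most 1, seen as an operation on
   bounded measurable functions only. *)
Definition subprob_functional U :=
  [/\ forall f g, bmeas f -> bmeas g -> U (fun x => f x + g x) = U f + U g,
      forall a f, bmeas f -> U (fun x => a * f x) = a * U f,
      forall f g, bmeas f -> bmeas g -> (forall x, f x <= g x) -> U f <= U g &
      U (cst 1) <= 1].

Lemma functional_sum U (I : Type) (r : seq I) (F : I -> T -> R) :
  subprob_functional U -> (forall i, bmeas (F i)) ->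
  U (fun x => \sum_(i <- r) F i x) = \sum_(i <- r) U (F i).
Proof.
move=> [UD UZ _ _] bF; elim: r => [|i r ih].
  rewrite big_nil; under eq_fun do rewrite big_nil -(mul0r 0).
  by rewrite UZ ?mul0r//; exact: bmeas_cst.
by under eq_fun do rewrite big_cons; rewrite UD ?ih ?big_cons//; exact: bmeas_sum.
Qed.

(** The sum counts the integers from 1 to [N] that are at most [y]; with the next lemma it
    approximates [y] from below with error at most 1. *)
Lemma sum_threshold_le (N : nat) (y : R) : 0 <= y ->
  \sum_(k < N) (k.+1%:R <= y)%R%:R <= y.
Proof.
move=> y0; elim: N => [|N ih]; first by rewrite big_ord0.
rewrite big_ord_recr /=; case: (leP N.+1%:R y) => [h|_]; last by rewrite mulr0n addr0.
apply: le_trans h; rewrite -natr1 lerD2r -[X in _ <= X%:R]card_ord -sum1_card natr_sum.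
by apply: ler_sum => k _; rewrite lern1 leq_b1.
Qed.

Lemma sum_threshold_ge (N : nat) (y : R) : y <= N%:R ->
  y <= \sum_(k < N) (k.+1%:R <= y)%R%:R + 1.
Proof.
elim: N => [|N ih] yN; first by rewrite big_ord0 add0r (le_trans yN).
have [yN'|Ny] := leP y N%:R.
  by rewrite (le_trans (ih yN'))// lerD2r big_ord_recr/= lerDl.
rewrite (le_trans yN)// -natr1 lerD2r -[X in X%:R <= _]card_ord -sum1_card natr_sum.
rewrite [leRHS]big_ord_recr /= ler_wpDr//.
apply: ler_sum => k _; suff -> : k.+1%:R <= y by [].
by rewrite (le_trans _ (ltW Ny))// ler_nat.
Qed.

(* Layer-cake: [f] is within [1/N] of the average of the indicators of
   its [N] super-level sets [{k/N <= f}]. *)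
Lemma functional_le_of_indic U V (delta : R) f :
  subprob_functional U -> subprob_functional V ->
  (forall A, measurable A -> U \1_A <= V \1_A + delta) ->
  bmeas f -> (forall x, 0 <= f x <= 1) -> U f <= V f + delta.
Proof.
move=> fU fV UV bf f01; apply/ler_addgt0Pr => /= e e0.
have [N _ Ne] : exists2 N : nat, True & (N.+1%:R)^-1 <= e.
  exists (Num.truncn e^-1) => //; rewrite invf_ple ?posrE//.
  exact/ltW/truncnS_gt.
pose S (k : nat) := [set x | k.+1%:R <= N.+1%:R * f x].
have mS k : measurable (S k).
  rewrite /S -[X in measurable X]setTI.
  by apply: measurable_fun_le => //; have [] := bmeasZ N.+1%:R bf.
(* The staircase below [f]: it satisfies [F <= f <= F + e], and its weights sum to 1, so the defect
   [delta] of the indicators is averaged rather than added up. *)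
pose F (x : T) : R := (N.+1%:R)^-1 * \sum_(k < N.+1) \1_(S k) x.
have bS : bmeas (fun x => \sum_(k < N.+1) \1_(S k) x).
  by apply: bmeas_sum => k _; exact: bmeas_indic.
have bF : bmeas F by exact: bmeasZ.
have SE x : \sum_(k < N.+1) \1_(S k) x =
    \sum_(k < N.+1) (k.+1%:R <= N.+1%:R * f x)%R%:R :> R.
  by apply: eq_bigr => k _; rewrite indicE mem_setE.
have N0 : 0 < N.+1%:R :> R by rewrite ltr0n.
have Ff x : F x <= f x.
  rewrite /F SE ler_pdivrMl//; apply: sum_threshold_le.
  by rewrite mulr_ge0//; have /andP[] := f01 x.
have fF x : f x <= F x + e * cst 1 x.
  apply: (@le_trans _ _ (F x + (N.+1%:R)^-1)); last by rewrite lerD2l mulr1.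
  rewrite /F SE -[X in _ + X]mulr1 -mulrDr ler_pdivlMl//.
  apply: sum_threshold_ge; rewrite ler_piMr//; by have /andP[] := f01 x.
have UVF : U F <= V F + delta.
  have [_ UZ _ _] := fU; have [_ VZ _ _] := fV.
  rewrite /F UZ// VZ// ler_pdivrMl// mulrDr mulVKf ?gt_eqF//.
  rewrite (functional_sum _ fU) => [|k]; last exact: bmeas_indic.
  rewrite (functional_sum _ fV) => [|k]; last exact: bmeas_indic.
  rewrite mulr_natl -[X in _ *+ X]card_ord -sumr_const -big_split/=.
  by apply: ler_sum => k _; exact: UV.
have [UD UZ Ule U1] := fU; have [_ _ Vle _] := fV.
have b1 : bmeas (fun x : T => (e : R) * cst (1 : R) x) by exact: (bmeasZ _ (bmeas_cst _)).
apply: (le_trans (Ule _ _ bf (bmeasD bF b1) fF)).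
rewrite UD// UZ; last exact: bmeas_cst.
apply: lerD; first by rewrite (le_trans UVF)// lerD2r; exact: Vle.
by rewrite ler_piMr// ltW.
Qed.

(** Rescale [f] affinely to [[0, 1]]. As [U] and [V] agree on constants, the shift [a] cancels and
    only the oscillation [D] multiplies [delta]. *)
Lemma functional_le_of_indic_osc U V (delta a D : R) f :
  subprob_functional U -> subprob_functional V -> U (cst 1) = V (cst 1) ->
  (forall A, measurable A -> U \1_A <= V \1_A + delta) ->
  bmeas f -> 0 < D -> (forall x, a <= f x <= a + D) -> U f <= V f + D * delta.
Proof.
move=> fU fV UV1 UV bf D0 faD.
pose g (x : T) : R := D^-1 * (f x + - a * cst 1 x).
have ba : bmeas (fun x => a * cst (1 : R) x) by exact: (bmeasZ _ (bmeas_cst _)).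
have bg : bmeas g.
  by exact: (bmeasZ _ (bmeasD bf (bmeasZ _ (bmeas_cst _)))).
have fE : f = (fun x => D * g x + a * cst 1 x).
  by apply/funext => x; rewrite /g mulVKf ?gt_eqF//= mulNr subrK.
have gle : U g <= V g + delta.
  apply: functional_le_of_indic => // x.
  have /andP[h1 h2] := faD x.
  by rewrite /g /= mulr1 mulr_ge0 ?invr_ge0 ?subr_ge0 ?(ltW D0)//= ler_pdivrMl// mulr1 lerBlDl.
have [UD UZ _ _] := fU; have [VD VZ _ _] := fV.
clearbody g; rewrite fE UD ?VD ?UZ ?VZ ?UV1//; try exact: bmeasZ; try exact: bmeas_cst.
have : D * U g <= D * V g + D * delta by rewrite -mulrDr ler_pM2l.
lra.
Qed.

Lemma functional_eq_of_indic U V f :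
  subprob_functional U -> subprob_functional V ->
  (forall A, measurable A -> U \1_A = V \1_A) -> bmeas f -> U f = V f.
Proof.
move=> fU fV UV bf; have [_ [M fM]] := bf.
have UV1 : U (cst 1) = V (cst 1).
  by have := UV _ (@measurableT _ T); rewrite indicT.
(* The bound [M] may vanish, while the rescaling divides by the width of the range; hence [1] is
   added. *)
have M0 : 0 < 2 * (`|M| + 1).
  by rewrite mulr_gt0// ltr_wpDl.
have fb x : - (`|M| + 1) <= f x <= - (`|M| + 1) + 2 * (`|M| + 1).
  have := fM x; have := ler_norm M; rewrite ler_norml => ? /andP[? ?].
  by apply/andP; split; lra.
apply/eqP; rewrite eq_le; apply/andP; split.
- rewrite -[V f]addr0 -[X in _ + X](mulr0 (2 * (`|M| + 1))).
  by apply: functional_le_of_indic_osc fb => // A mA; rewrite UV ?addr0.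
- rewrite -[U f]addr0 -[X in _ + X](mulr0 (2 * (`|M| + 1))).
  by apply: functional_le_of_indic_osc fb => // A mA; rewrite UV ?addr0.
Qed.

Lemma functional_Rintegral (mu : probability T R) :
  subprob_functional (fun f => \int[mu]_x f x).
Proof.
split=> [f g bf bg|a f bf|f g bf bg fg|].
- by rewrite RintegralD//; exact: bmeas_integrable.
- by rewrite RintegralZl//; exact: bmeas_integrable.
- by apply: le_Rintegral => //; exact: bmeas_integrable.
- by rewrite Rintegral_cst// [X in fine X](probability_setT mu) mulr1.
Qed.

End BoundedMeasurable.

(** * The transition operator, its contraction under mixing, and the Markov property *)

Section MarkovOperator.
Set Implicit Arguments. Unset Strict Implicit. Unset Printing Implicit Defensive.
Context (R : realType) (dO dZ : measure_display)
        (Omega : measurableType dO) (Z : measurableType dZ).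
Implicit Types (f : Z -> R) (A : set Z) (B : set Omega).

(** The Markov operator on functions: the conditional expectation of [f (z t.+1)] given
    [z t = x]. *)
Definition kernel_op (Q : Z -> probability Z R) f : Z -> R :=
  fun x => \int[Q x]_y f y.

Lemma Rintegral_indic (d : measure_display) (T : measurableType d)
    (mu : probability T R) (A : set T) :
  measurable A -> \int[mu]_x \1_A x = fine (mu A).
Proof. by move=> mA; rewrite /Rintegral integral_indic// setIT. Qed.

Lemma EFin_Rintegral (d : measure_display) (T : measurableType d)
    (mu : probability T R) (f : T -> R) :
  bmeas f -> (\int[mu]_x f x)%:E = (\int[mu]_x (f x)%:E)%E.
Proof.
by move=> bf; rewrite fineK//; exact/integrable_fin_num/bmeas_integrable.
Qed.

Lemma Rintegral_const (d : measure_display) (T : measurableType d)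
    (mu : probability T R) (a : R) : \int[mu]_x a = a.
Proof. by rewrite Rintegral_cst// [X in fine X](probability_setT mu) mulr1. Qed.

Section Kernel.
Variables (Q : Z -> probability Z R).
Hypothesis mQ : forall A, measurable A ->
  measurable_fun [set: Z] (fun x : Z => (Q x A : \bar R)).

Lemma kernel_op_cst (a : R) : kernel_op Q (cst a) = cst a.
Proof. by apply/funext => x; rewrite /kernel_op/= Rintegral_const. Qed.

Lemma functional_kernel_op x : subprob_functional (fun f => kernel_op Q f x).
Proof. exact: functional_Rintegral. Qed.

Lemma bmeas_kernel_op f : bmeas f -> bmeas (kernel_op Q f).
Proof.
move=> bf; have [mf [M fM]] := bf.
have b1 : bmeas (fun x : Z => f x + M) by exact (bmeasD bf (bmeas_cst _ M)).
split; last first.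
  exists M => x; rewrite ler_norml; apply/andP; split.
    rewrite -[leLHS](Rintegral_const (Q x)).
    apply: le_Rintegral => //; try exact: bmeas_integrable.
      exact/bmeas_integrable/bmeas_cst.
    by move=> y _; have := fM y; rewrite ler_norml => /andP[].
  rewrite -[leRHS](Rintegral_const (Q x)).
  apply: le_Rintegral => //; try exact: bmeas_integrable.
    exact/bmeas_integrable/bmeas_cst.
  by move=> y _; have := fM y; rewrite ler_norml => /andP[].
(* Adding the bound [M] makes the integrand nonnegative, as measurability of a kernel integral
   requires; the shift is subtracted afterwards. *)
have -> : kernel_op Q f = fun x => fine (\int[Q x]_y (f y + M)%:E)%E - M.
  apply/funext => x; have [QD _ _ _] := functional_kernel_op x.
  rewrite -[fine _]/(kernel_op Q (fun y => f y + M) x).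
  by have := QD _ (cst M) bf (bmeas_cst _ M); rewrite kernel_op_cst => ->; rewrite addrK.
apply: measurable_funB => //.
apply/measurable_EFinP/(eq_measurable_fun (fun x => \int[Q x]_y (f y + M)%:E)%E).
  move=> x _ /=; rewrite fineK//; exact/integrable_fin_num/bmeas_integrable.
apply: measurable_fun_integral_kernel => //; last first.
  by apply/measurable_EFinP; have [] := b1.
by move=> y; rewrite lee_fin -lerBlDr sub0r; have := fM y; rewrite ler_norml => /andP[].
Qed.

Lemma bmeas_iter_kernel_op n f : bmeas f -> bmeas (iter n (kernel_op Q) f).
Proof. by elim: n => //= n ih bf; apply/bmeas_kernel_op/ih. Qed.

Lemma iter_kernel_op_cst n (a : R) : iter n (kernel_op Q) (cst a) = cst a.
Proof. by elim: n => //= n ->; rewrite kernel_op_cst. Qed.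

Lemma functional_comp_kernel_op (U : (Z -> R) -> R) :
  subprob_functional U -> subprob_functional (fun f => U (kernel_op Q f)).
Proof.
move=> [UD UZ Ule U1]; split=> [f g bf bg|a f bf|f g bf bg fg|].
- rewrite -UD; try exact: bmeas_kernel_op.
  by congr U; apply/funext => x; have [->] := functional_kernel_op x.
- rewrite -UZ; last exact: bmeas_kernel_op.
  by congr U; apply/funext => x; have [_ ->] := functional_kernel_op x.
- apply: Ule => [||x]; try exact: bmeas_kernel_op.
  by have [_ _ /(_ f g bf bg fg)] := functional_kernel_op x.
- by rewrite kernel_op_cst.
Qed.

Lemma functional_iter_kernel_op n x :
  subprob_functional (fun f => iter n (kernel_op Q) f x).
Proof.
elim: n => [|n ih]; first by split=> //= f g _ _ /(_ x).
rewrite (_ : (fun f => _) = fun f => iter n (kernel_op Q) (kernel_op Q f) x).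
  exact: (functional_comp_kernel_op ih).
by apply/funext => f; rewrite iterSr.
Qed.

(** Turns the mixing assumption, stated for transition probabilities of sets, into one about
    iterates of the operator. *)
Lemma kiterE n x A : measurable A ->
  kiter Q n x A = (iter n (kernel_op Q) \1_A x)%:E.
Proof.
move=> mA; elim: n x => [|n ih] x; first by rewrite /= diracE indicE.
rewrite /= EFin_Rintegral; last exact/bmeas_iter_kernel_op/bmeas_indic.
by apply: eq_integral => y _; rewrite ih.
Qed.

Section Mixing.
Variables (mu : probability Z R) (tau : nat).
Hypotheses (statmu : stationary Q mu) (mix : mixing_time_bound Q mu tau).

Lemma Rintegral_kernel_op f : bmeas f ->
  \int[mu]_x kernel_op Q f x = \int[mu]_x f x.
Proof.
apply: (@functional_eq_of_indic _ _ _ (fun f => \int[mu]_x kernel_op Q f x)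
  (fun f => \int[mu]_x f x)).
- exact: (functional_comp_kernel_op (functional_Rintegral mu)).
- exact: functional_Rintegral.
- move=> A mA; rewrite Rintegral_indic// statmu// /Rintegral; congr fine.
  apply: eq_integral => x _.
  rewrite EFin_Rintegral; last exact: bmeas_indic.
  by rewrite integral_indic// setIT.
Qed.

Lemma Rintegral_iter_kernel_op n f : bmeas f ->
  \int[mu]_x iter n (kernel_op Q) f x = \int[mu]_x f x.
Proof.
elim: n => // n ih bf.
by rewrite Rintegral_kernel_op ?ih//; exact: bmeas_iter_kernel_op.
Qed.

(** From two starting points the laws after [tau] steps are each within [1/4] of [mu], hence within
    [1/2] of each other on every set; the comparison by oscillation turns this into the factor
    [1/2]. *)
Lemma iter_kernel_op_osc f (D : R) : bmeas f -> 0 < D ->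
  (forall x y, f x - f y <= D) ->
  forall x y, iter tau (kernel_op Q) f x - iter tau (kernel_op Q) f y <= D / 2.
Proof.
move=> bf D0 fD x y; rewrite lerBlDl.
have [_ [M fM]] := bf.
have lbf : has_inf (range f).
  split; first by exists (f x), x.
  by exists (- M) => _ [u _ <-]; have := fM u; rewrite ler_norml => /andP[].
apply: (@functional_le_of_indic_osc _ _ _ (fun f => iter tau (kernel_op Q) f x)
  (fun f => iter tau (kernel_op Q) f y) 2^-1 (inf (range f)) D) => //.
- exact: functional_iter_kernel_op.
- exact: functional_iter_kernel_op.
- by rewrite !iter_kernel_op_cst.
- move=> A mA; have := mix x mA; have := mix y mA; rewrite !kiterE//.
  have : mu A \is a fin_num by exact: fin_num_measure.
  move: (mu A) => [m| |]// _; rewrite -!EFinB /= !lee_fin !ler_norml.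
  by move=> /andP[? ?] /andP[? ?]; lra.
- move=> u; apply/andP; split; first by apply: ge_inf; [exact: lbf.2|exists u].
  rewrite -lerBlDr; apply: lb_le_inf; first exact: lbf.1.
  by move=> _ [v _ <-]; have := fD u v; lra.
Qed.

Lemma iter_kernel_op_osc_exp k f (D : R) : bmeas f -> 0 < D ->
  (forall x y, f x - f y <= D) -> forall x y,
  iter (k * tau) (kernel_op Q) f x - iter (k * tau) (kernel_op Q) f y <= D / 2 ^+ k.
Proof.
move=> bf D0 fD; elim: k => [|k ih] x y; first by rewrite divr1.
rewrite mulSn !iterD exprSr invfM mulrA; apply: iter_kernel_op_osc => //.
- exact: bmeas_iter_kernel_op.
- by rewrite divr_gt0// exprn_gt0.
Qed.

(** By stationarity the iterate still has [mu]-mean 0, so its value at [x] is the [mu]-average over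
    [y] of its differences between [x] and [y], and these are bounded by the contracted
    oscillation. *)
Lemma iter_kernel_op_decay k f (M : R) : bmeas f -> 0 < M ->
  (forall x, `|f x| <= M) -> \int[mu]_x f x = 0 ->
  forall x, iter (k * tau) (kernel_op Q) f x <= 2 * M / 2 ^+ k.
Proof.
move=> bf M0 fM f0 x; rewrite -[leLHS](Rintegral_const mu) -[leRHS]addr0 -f0.
rewrite -(Rintegral_iter_kernel_op (k * tau) bf) -[X in X + _](Rintegral_const mu).
have bi := bmeas_iter_kernel_op (k * tau) bf.
rewrite -RintegralD//; try exact: bmeas_integrable; last first.
  exact/bmeas_integrable/bmeas_cst.
apply: le_Rintegral => //; try exact/bmeas_integrable/bmeas_cst.
  exact/bmeas_integrable/(bmeasD (bmeas_cst _ _)).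
move=> y _; rewrite -lerBlDr; apply: iter_kernel_op_osc_exp => //; first by rewrite mulr_gt0.
move=> u v; have := fM u; have := fM v; rewrite !ler_norml.
by move=> /andP[? ?] /andP[? ?]; lra.
Qed.

End Mixing.
End Kernel.

(** * The Markov property for bounded functions, relative to the filtration *)

Section Chain.
Variables (P : probability Omega R) (F : nat -> set (set Omega))
  (z : nat -> Omega -> Z) (Q : Z -> probability Z R).
Hypotheses (filF : filtration F) (chain : markov_chain P F z Q).

Lemma filtration_measurable t B : F t B -> measurable B.
Proof. by have [_ [+ _]] := filF t; exact. Qed.

Lemma filtration_le s t B : (s <= t)%N -> F s B -> F t B.
Proof.
elim: t => [|t ih]; first by rewrite leqn0 => /eqP ->.
rewrite leq_eqVlt => /predU1P[->//|]; rewrite ltnS => st FB.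
by have [_ [_]] := filF t; apply; exact: ih.
Qed.

Lemma chain_measurable t : measurable_fun setT (z t).
Proof.
by move=> _ A mA; rewrite setTI; have [_ [+ _]] := chain => /(_ t A mA) /filtration_measurable.
Qed.

Lemma bmeas_chain t f : bmeas f -> bmeas (fun w => f (z t w)).
Proof.
move=> [mf [M fM]]; split; last by exists M.
exact: (measurableT_comp mf (chain_measurable t)).
Qed.

Lemma functional_chain t B : measurable B ->
  subprob_functional (fun f => \int[P]_w (\1_B w * f (z t w))).
Proof.
move=> mB; have b1 := @bmeas_indic R _ _ _ mB.
have bB f : bmeas f -> bmeas (fun w => \1_B w * f (z t w)).
  by move=> bf; apply: bmeasM => //; exact: bmeas_chain.
split=> [f g bf bg|a f bf|f g bf bg fg|].
- under eq_Rintegral do rewrite mulrDr.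
  by rewrite RintegralD//; apply/bmeas_integrable/bB.
- under eq_Rintegral do rewrite mulrCA.
  by rewrite RintegralZl//; apply/bmeas_integrable/bB.
- apply: le_Rintegral => //; try exact/bmeas_integrable/bB.
  by move=> w _; rewrite ler_wpM2l// indicE.
- rewrite -[leRHS](Rintegral_const P).
  apply: le_Rintegral => //; try exact/bmeas_integrable/bmeas_cst.
    exact/bmeas_integrable/bB/bmeas_cst.
  by move=> w _; rewrite /= mulr1 indicE; case: (w \in B).
Qed.

Lemma chain_step t B f : F t B -> bmeas f ->
  \int[P]_w (\1_B w * f (z t.+1 w)) = \int[P]_w (\1_B w * kernel_op Q f (z t w)).
Proof.
move=> FB; have mB := filtration_measurable FB; have [mQ [_ step]] := chain.
apply: (@functional_eq_of_indic _ _ _ (fun f => \int[P]_w (\1_B w * f (z t.+1 w)))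
  (fun f => \int[P]_w (\1_B w * kernel_op Q f (z t w)))).
- exact: functional_chain.
- exact: (functional_comp_kernel_op mQ (functional_chain t mB)).
move=> A mA; rewrite /Rintegral; congr fine.
transitivity (P (B `&` z t.+1 @^-1` A `&` setT)).
  rewrite -integral_indic//.
    by apply: eq_integral => w _; rewrite indicI.
  apply: measurableI => //; rewrite -[X in measurable X]setTI.
  exact: chain_measurable.
rewrite setIT step// [LHS]integral_mkcond.
apply: eq_integral => w _.
rewrite /patch indicE; case: ifPn => _; rewrite ?mul0r// mul1r.
by rewrite EFin_Rintegral ?integral_indic ?setIT//; exact: bmeas_indic.
Qed.

(** The last step is integrated out first, which is allowed because [B] also belongs to every later
    sigma-algebra. *)
Lemma chain_steps s n B f : F s B -> bmeas f ->
  \int[P]_w (\1_B w * f (z (s + n) w)) =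
  \int[P]_w (\1_B w * iter n (kernel_op Q) f (z s w)).
Proof.
have [mQ _] := chain.
move=> FB; elim: n f => [|n ih] f bf; first by rewrite addn0.
rewrite addnS chain_step//; last exact: (filtration_le (leq_addr _ _) FB).
by rewrite ih ?iterSr//; exact: bmeas_kernel_op.
Qed.

(** The factor [P B] on the right is essential: summed over a partition into past events, the bounds
    add up without loss, however many cells there are. *)
Lemma chain_decay (mu : probability Z R) (tau : nat) s k B f (M : R) :
  stationary Q mu -> mixing_time_bound Q mu tau -> F s B ->
  bmeas f -> 0 < M -> (forall x, `|f x| <= M) -> \int[mu]_x f x = 0 ->
  \int[P]_w (\1_B w * f (z (s + k * tau)%N w)) <= 2 * M / 2 ^+ k * fine (P B).
Proof.
move=> st mix FB bf M0 fM f0; have [mQ _] := chain.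
have mB := filtration_measurable FB; have b1 := @bmeas_indic R _ _ _ mB.
rewrite chain_steps// -Rintegral_indic// -RintegralZl//; last exact: bmeas_integrable.
have bi := bmeas_chain s (bmeas_iter_kernel_op mQ (k * tau) bf).
apply: le_Rintegral => //.
- exact/bmeas_integrable/bmeasM.
- exact/bmeas_integrable/bmeasZ.
move=> w _; rewrite mulrC ler_wpM2r ?indicE//.
exact: (iter_kernel_op_decay mQ st).
Qed.

End Chain.
End MarkovOperator.

(** * Approximating an adapted iterate by finitely many points of the constraint set *)

Section Discretization.
Set Implicit Arguments. Unset Strict Implicit. Unset Printing Implicit Defensive.

Lemma sigma_algebra_ffun_fiber (T : Type) (S : set (set T)) (I : finType)
    (c : T -> {ffun I -> bool}) (k : {ffun I -> bool}) :
  sigma_algebra setT S -> (forall i b, S [set w | c w i = b]) ->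
  S (c @^-1` [set k]).
Proof.
move=> sS Sc.
have [ST _ _ SI] : [/\ S setT, setSD_closed S, ndseq_closed S & setI_closed S].
  by apply/(sigma_algebraP (U := setT)).
have -> : c @^-1` [set k] = \big[setI/setT]_(i <- enum I) [set w | c w i = k i].
  rewrite -bigcap_seq; apply/seteqP; split => w /=; first by move=> ck i _; rewrite /= ck.
  by move=> h; apply/ffunP => i; apply: h; rewrite /= mem_enum.
by apply: (big_ind S) => // i _; exact: Sc.
Qed.

(* The cells are cut out by the thresholds [- C1 + k * delta] in each
   coordinate. *)
Lemma finite_discretization (R : realType) (d : nat) (T : Type)
    (S : set (set T)) (C : set 'rV[R]_d) (th0 : 'rV[R]_d) (C1 eps : R)
    (th : T -> 'rV[R]_d) :
  sigma_algebra setT S -> C th0 -> (forall x, C x -> enorm x <= C1) ->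
  (forall w, C (th w)) ->
  (forall i B, measurable B -> S ((fun w => th w ord0 i) @^-1` B)) ->
  0 < eps ->
  exists (I : finType) (c : T -> I) (rep : I -> 'rV[R]_d),
    [/\ forall i, S (c @^-1` [set i]), forall i, C (rep i) &
        forall w, enorm (th w - rep (c w)) <= eps].
Proof.
move=> sS C0 CC1 Cth Sth eps0.
(* Dividing by [d.+1] also covers dimension 0, and [d%:R * delta <= eps] is all that is needed. *)
pose delta : R := eps / d.+1%:R.
have delta0 : 0 < delta by rewrite divr_gt0// ltr0n.
pose N := (Num.truncn (2 * C1 / delta)).+1.
pose a (k : nat) : R := - C1 + k%:R * delta.
pose code (x : 'rV[R]_d) : {ffun 'I_d * 'I_N -> bool} :=
  [ffun ik : 'I_d * 'I_N => a ik.2 <= x ord0 ik.1].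
(* Each nonempty cell is represented by one of its own points in [C]; [th0] is the default for codes
   that no point of [C] has. *)
pose rep k := xget th0 [set x | C x /\ code x = k].
have repP x : C x -> C (rep (code x)) /\ code (rep (code x)) = code x.
  by move=> Cx; rewrite /rep; case: xgetP => [y -> []//|/(_ x)]; case.
have Crep k : C (rep k).
  by rewrite /rep; case: xgetP => [y -> []|].
(* If [x] exceeded [y] by more than [delta] in a coordinate, the largest threshold below [x] would
   separate them; [N] is large enough for that threshold to be on the grid. *)
have close x y i : C x -> C y -> code x = code y -> x ord0 i - y ord0 i <= delta.
  move=> Cx Cy xy; rewrite leNgt; apply/negP => lt.
  have := le_trans (entry_le_enorm x i) (CC1 _ Cx).
  rewrite ler_norml => /andP[x1 x2].
  have xa : 0 <= (x ord0 i + C1) / delta by rewrite divr_ge0 ?(ltW delta0)//; lra.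
  have /andP[] := truncn_itv xa; set k := Num.truncn _.
  rewrite ler_pdivlMr// ltr_pdivrMr// => k1 k2.
  have kN : (k < N)%N.
    rewrite ltnS; apply: le_truncn; rewrite ler_pM2r ?invr_gt0//; lra.
  have /ffunP/(_ (i, Ordinal kN)) := xy; rewrite !ffunE /= /a.
  have -> : - C1 + k%:R * delta <= x ord0 i by lra.
  move=> /esym ky; move: k2; rewrite -natr1 mulrDl mul1r; lra.
exists {ffun 'I_d * 'I_N -> bool}, (fun w => code (th w)), rep; split => //.
- move=> k; apply: (sigma_algebra_ffun_fiber (c := fun w => code (th w))) => // -[i m] b.
  under eq_set do rewrite ffunE/=.
  apply: (Sth i [set r | (a m <= r) = b]).
  case: b.
  + rewrite (_ : [set _ | _] = `[a m, +oo[%classic)//.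
    by apply/seteqP; split => r; rewrite /= in_itv/= andbT.
  + rewrite (_ : [set _ | _] = `]-oo, a m[%classic)//.
    by apply/seteqP; split => r; rewrite /= in_itv/= ltNge => /negP/negP// /negbTE.
- move=> w; have [Cr cr] := repP _ (Cth w).
  apply: (@le_trans _ _ (d%:R * delta)).
    apply: enorm_le_entries => [|i]; first exact: ltW.
    rewrite !mxE ler_norml lerNl opprB; apply/andP; split; exact: close.
  rewrite /delta mulrCA ler_piMr ?(ltW eps0)// ler_pdivrMr ?ltr0n// mul1r ler_nat.
  exact: leqnSn.
Qed.

End Discretization.

(** * Elementary estimates for sums, logarithms and step sizes *)

Section RealSums.
Set Implicit Arguments. Unset Strict Implicit. Unset Printing Implicit Defensive.
Context (R : realType).

(** Summation by parts against the nondecreasing weights [1 / (2 eta t)]. The induction carries the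
    sharper numerator [B - D T.+1], so that each new difference can be merged with it. *)
Lemma abel_le (eta D : nat -> R) (B : R) (T : nat) :
  (forall t, 0 < eta t) -> (forall t, eta t.+1 <= eta t) ->
  (forall t, 0 <= D t <= B) ->
  \sum_(1 <= t < T.+1) (D t - D t.+1) / (2 * eta t) <= B / (2 * eta T).
Proof.
move=> eta0 etaS DB.
suff : \sum_(1 <= t < T.+1) (D t - D t.+1) / (2 * eta t) <=
    (B - D T.+1) / (2 * eta T).
  move=> /le_trans; apply; rewrite ler_pM2r ?invr_gt0 ?mulr_gt0//.
  by have /andP[] := DB T.+1; lra.
elim: T => [|T ih].
  by rewrite big_geq// divr_ge0 ?mulr_ge0 ?(ltW (eta0 _))// subr_ge0; case/andP: (DB 1%N).
rewrite big_nat_recr//= (le_trans (lerD ih (lexx _)))//.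
apply: (@le_trans _ _ ((B - D T.+1) / (2 * eta T.+1) + (D T.+1 - D T.+2) / (2 * eta T.+1))).
  rewrite lerD2r ler_wpM2l//; first by rewrite subr_ge0; case/andP: (DB T.+1).
  by rewrite lef_pV2 ?posrE ?mulr_gt0// ler_pM2l.
by rewrite -mulrDl addrA subrK.
Qed.

Lemma sum_from1_le (x : nat -> R) (n : nat) : (forall t, 0 <= x t) ->
  \sum_(1 <= t < n.+1) x t <= \sum_(t < n.+1) x t.
Proof. by move=> x0; rewrite -(big_mkord xpredT x) big_ltn// lerDr. Qed.

Lemma sum_shift_le (eta : nat -> R) (h n : nat) : (forall t, 0 < eta t) ->
  \sum_(t < n) (if (t < h)%N then 0 else eta (t - h)%N) <= \sum_(t < n) eta t.
Proof.
move=> eta0.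
have -> : \sum_(t < n) (if (t < h)%N then 0 else eta (t - h)%N) =
    \sum_(t < n - h) eta t.
  elim: n => [|n ih]; first by rewrite sub0n !big_ord0.
  rewrite big_ord_recr /= ih; case: ltnP => hn.
    by rewrite addr0 (_ : (n.+1 - h = n - h)%N)//; lia.
  by rewrite subSn// big_ord_recr.
rewrite -!(big_mkord xpredT eta) (@big_cat_nat _ _ _ (n - h) 0 n)//= ?leq_subr// lerDl.
by apply: sumr_ge0 => i _; exact: ltW.
Qed.

Lemma sum_lt_le (h n : nat) : (\sum_(t < n) (t < h) <= minn h n)%N.
Proof.
elim: n => [|n ih]; first by rewrite big_ord0.
by rewrite big_ord_recr /=; move: ih; case hn : (n < h)%N => /=; lia.
Qed.

Lemma ln2_ge_half : 2^-1 <= ln 2 :> R.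
Proof.
have := @le_ln1Dx R (- 2^-1); rewrite (_ : 1 + - 2^-1 = 2^-1); last by lra.
by rewrite lnV ?posrE// => /(_ _); lra.
Qed.

Lemma ln_ge_half (T : nat) : (2 <= T)%N -> 2^-1 <= ln T%:R :> R.
Proof.
move=> T2; apply: le_trans ln2_ge_half _.
by rewrite ler_ln ?posrE ?ltr0n ?ler_nat//; lia.
Qed.

(** From [2 ^ (k - 1) < T] and [ln 2 >= 1/2] one gets [k <= 2 ln T + 1], and [ln T >= 1/2] absorbs
    the 1. *)
Lemma up_log2_le (T : nat) : (2 <= T)%N -> (up_log 2 T)%:R <= 4 * ln T%:R :> R.
Proof.
move=> T2; have /andP[h _] := up_log_bounds (ltnSn 1) T2.
have : ln ((2 ^ (up_log 2 T).-1)%:R) <= ln T%:R :> R.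
  by rewrite ler_ln ?posrE ?ltr0n ?expn_gt0 ?ler_nat//; lia.
rewrite natrX lnXn// -(mulr_natl (ln _)) => h1.
have h2 := ln2_ge_half; have h3 := ln_ge_half T2.
have : (up_log 2 T).-1%:R * 2^-1 <= (up_log 2 T).-1%:R * ln 2 :> R.
  by rewrite ler_wpM2l.
have : (up_log 2 T)%:R <= (up_log 2 T).-1%:R + 1 :> R.
  by rewrite natr1 ler_nat; lia.
lra.
Qed.

(** With [a], [b] the roots of [n] and [n + 1], the induction step [2 a + 1 / b <= 2 b] amounts to
    [(a - b)^2 >= 0]. *)
Lemma sum_inv_sqrt_le (n : nat) :
  \sum_(1 <= t < n.+1) (Num.sqrt t%:R)^-1 <= 2 * Num.sqrt n%:R :> R.
Proof.
elim: n => [|n ih]; first by rewrite big_geq// mulr_ge0// sqrtr_ge0.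
rewrite big_nat_recr//= (le_trans (lerD ih (lexx _)))//.
set b := Num.sqrt n.+1%:R; set a := Num.sqrt n%:R.
have b0 : 0 < b by rewrite sqrtr_gt0 ltr0n.
have ab : b ^+ 2 = a ^+ 2 + 1 by rewrite !sqr_sqrtr// natr1.
have a0 : 0 <= a := sqrtr_ge0 _.
rewrite -(ler_pM2r b0) mulrDl mulVf ?gt_eqF//.
have := sqr_ge0 (a - b); rewrite sqrrB; lra.
Qed.

(* Either [1 <= T * eta], or [T < eta^-1]. *)
Lemma min_le_step (a S eta T : R) : 0 <= a -> 0 < eta -> 0 <= T -> T * eta <= S ->
  Num.min a T <= a * S + eta^-1.
Proof.
move=> a0 eta0 T0 TS; have ei : 0 < eta^-1 by rewrite invr_gt0.
have [h|h] := leP 1 (T * eta).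
  rewrite ge_min; apply/orP; left.
  have : a * 1 <= a * S by rewrite ler_wpM2l//; lra.
  lra.
rewrite ge_min; apply/orP; right.
have : T <= eta^-1 by rewrite -[leRHS]mul1r ler_pdivlMr// ltW.
have : 0 <= a * S by rewrite mulr_ge0// (le_trans _ TS)// mulr_ge0// ltW.
lra.
Qed.

End RealSums.

(** * Monotonicity, finite sums and square-integrability for integrals *)

Section IntegralLemmas.
Set Implicit Arguments. Unset Strict Implicit. Unset Printing Implicit Defensive.
Context (R : realType) (d : measure_display) (T : measurableType d).

(* No measurability is required: both parts are suprema over simple
   functions below the integrand. *)
Lemma le_integral_pointwise (mu : {measure set T -> \bar R}) (f g : T -> \bar R) :
  (forall x, (f x <= g x)%E) -> (\int[mu]_x f x <= \int[mu]_x g x)%E.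
Proof.
move=> fg; rewrite /integral !patch_setT; apply: leeB; apply: ereal_sup_le => _ [h hf <-];
  exists h => // x; apply: (le_trans (hf x)).
- by rewrite !funeposE ge_max !le_max fg lexx orbT.
- by rewrite !funenegE ge_max !le_max leeN2 fg lexx orbT.
Qed.

Lemma Rintegral_sum (mu : probability T R) (I : Type) (r : seq I) (F : I -> T -> R) :
  (forall i, mu.-integrable setT (EFin \o F i)) ->
  mu.-integrable setT (EFin \o (fun x => \sum_(i <- r) F i x)) /\
  \int[mu]_x (\sum_(i <- r) F i x) = \sum_(i <- r) \int[mu]_x F i x.
Proof.
move=> iF; elim: r => [|i r [ih1 ih2]].
  rewrite big_nil; under eq_Rintegral do rewrite big_nil.
  rewrite Rintegral_const; split => //.
  under eq_fun do rewrite big_nil; exact/bmeas_integrable/bmeas_cst.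
rewrite big_cons; under eq_Rintegral do rewrite big_cons.
rewrite RintegralD// ih2; split => //.
under eq_fun do rewrite big_cons.
exact: (@integrableD _ _ _ mu setT measurableT _ _ (iF i) ih1).
Qed.

Lemma integrable_of_sqr (mu : probability T R) (e : T -> R) :
  measurable_fun setT e -> (\int[mu]_x (e x ^+ 2)%:E < +oo)%E ->
  mu.-integrable setT (EFin \o e).
Proof.
move=> me e2.
have i2 : mu.-integrable setT (EFin \o (fun x => e x ^+ 2)).
  apply/integrableP; split; first exact/measurable_EFinP/measurable_funX.
  rewrite (eq_integral (fun x => (e x ^+ 2)%:E))// => x _ /=.
  by rewrite ger0_norm// sqr_ge0.
have i1 : mu.-integrable setT (EFin \o cst 1) by exact/bmeas_integrable/bmeas_cst.
apply: (le_integrable _ _ _ (integrableD _ i1 i2)) => //.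
  exact/measurable_EFinP.
move=> x _ /=; rewrite lee_fin [leRHS]ger0_norm ?addr_ge0 ?sqr_ge0//.
have := sqr_ge0 (`|e x| - 1); rewrite sqrrB real_normK ?num_real//.
have := sqr_ge0 (e x); lra.
Qed.

End IntegralLemmas.

(** * The gradient noise: centring, boundedness and Lipschitz dependence on the parameter *)

Section GradientNoise.
Set Implicit Arguments. Unset Strict Implicit. Unset Printing Implicit Defensive.
Context (R : realType) (d : nat) (dZ : measure_display) (Z : measurableType dZ).
Variables (mu : probability Z R) (g : 'rV[R]_d -> Z -> 'rV[R]_d)
  (C : set 'rV[R]_d) (thstar : 'rV[R]_d) (C0 C1 G : R).

Definition mean_field (th : 'rV[R]_d) : 'rV[R]_d :=
  \row_(i < d) \int[mu]_x (g th x) ord0 i.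

(** Centred under [mu] for each fixed [th], but not along the trajectory, where the iterate may be
    correlated with the current state. *)
Definition grad_noise (th : 'rV[R]_d) (x : Z) : R :=
  dotv (mean_field th - g th x) (th - thstar).

Hypotheses (mg : forall th i, measurable_fun setT (fun x => (g th x) ord0 i))
  (C0_gt0 : 0 < C0) (C1_gt0 : 0 < C1) (G_gt0 : 0 < G)
  (mean_le : forall th, enorm (mean_field th) <= C0)
  (g_le : forall th x, enorm (g th x) <= C0)
  (C_le : forall th, C th -> enorm th <= C1) (C_star : C thstar)
  (g_lip : forall x th th', C th -> C th' ->
     enorm (g th x - g th' x) <= G * enorm (th - th')).

Lemma bmeas_dotv th v : bmeas (fun x => dotv (g th x) v).
Proof.
apply: bmeas_sum => i _; apply: (@bmeasM _ _ _ (fun x => g th x ord0 i) (cst (v ord0 i))).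
  by split=> //; exists C0 => x; exact: le_trans (entry_le_enorm _ _) (g_le _ _).
exact: bmeas_cst.
Qed.

Lemma dotv_mean_field th v : dotv (mean_field th) v = \int[mu]_x dotv (g th x) v.
Proof.
pose F i x := v ord0 i * g th x ord0 i.
have bg i : bmeas (fun x => g th x ord0 i).
  by split=> //; exists C0 => x; exact: le_trans (entry_le_enorm _ _) (g_le _ _).
have bF i : bmeas (F i) by exact: bmeasZ.
transitivity (\int[mu]_x \sum_(i < d) F i x); last first.
  by apply: eq_Rintegral => x _; apply: eq_bigr => i _; rewrite mulrC.
rewrite (functional_sum _ (functional_Rintegral mu) bF).
apply: eq_bigr => i _; rewrite mxE mulrC /F RintegralZl//.
exact: bmeas_integrable.
Qed.

(** Pairing with a fixed [v] reduces the Lipschitz bound of the mean to a scalar integral of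
    pointwise bounds. *)
Lemma dotv_mean_field_lip th th' v : C th -> C th' ->
  dotv (mean_field th - mean_field th') v <= G * enorm (th - th') * enorm v.
Proof.
move=> Cth Cth'; rewrite dotvDl dotvNl !dotv_mean_field.
have i1 := bmeas_integrable mu (bmeas_dotv th v).
have i2 := bmeas_integrable mu (bmeas_dotv th' v).
rewrite -RintegralB// -[leRHS](Rintegral_const mu); apply: le_Rintegral => //.
- exact: (@integrableB _ _ _ mu setT measurableT _ _ i1 i2).
- exact/bmeas_integrable/bmeas_cst.
move=> x _; rewrite -dotvNl -dotvDl (le_trans (dotv_le_enorm _ _))//.
by rewrite ler_wpM2r ?enorm_ge0// g_lip.
Qed.

Lemma star_dist_le th : C th -> enorm (th - thstar) <= 2 * C1.
Proof.
move=> Cth; rewrite (le_trans (enormD _ _))// enormN.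
have := C_le Cth; have := C_le C_star; lra.
Qed.

Lemma bmeas_grad_noise th : bmeas (grad_noise th).
Proof.
have -> : grad_noise th = fun x =>
    dotv (mean_field th) (th - thstar) + (-1) * dotv (g th x) (th - thstar).
  by apply/funext => x; rewrite /grad_noise dotvDl dotvNl mulN1r.
apply: (@bmeasD _ _ _ (cst _)); first exact: bmeas_cst.
by apply: bmeasZ; exact: bmeas_dotv.
Qed.

Lemma Rintegral_grad_noise th : \int[mu]_x grad_noise th x = 0.
Proof.
rewrite /grad_noise; under eq_Rintegral do rewrite dotvDl dotvNl.
rewrite RintegralB//; last 2 first.
- exact/bmeas_integrable/bmeas_cst.
- exact/bmeas_integrable/bmeas_dotv.
by rewrite Rintegral_const dotv_mean_field subrr.
Qed.

Lemma norm_grad_noise_le th x : C th -> `|grad_noise th x| <= 4 * C0 * C1.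
Proof.
move=> Cth; rewrite (le_trans (norm_dotv_le _ _))//.
rewrite (_ : 4 * C0 * C1 = (2 * C0) * (2 * C1)); last by ring.
apply: ler_pM; rewrite ?enorm_ge0 ?star_dist_le//.
rewrite (le_trans (enormD _ _))// enormN.
have := mean_le th; have := g_le th x; lra.
Qed.

(** Changing [th] inside the mean field and inside [g] costs [2 * G * C1] each, since [th - thstar]
    has norm at most [2 * C1]; changing the vector paired with them costs [2 * C0]. *)
Lemma grad_noise_lip th th' x : C th -> C th' ->
  grad_noise th x <= grad_noise th' x + (4 * G * C1 + 2 * C0) * enorm (th - th').
Proof.
move=> Cth Cth'; rewrite /grad_noise.
have -> : dotv (mean_field th - g th x) (th - thstar) =
  dotv (mean_field th' - g th' x) (th' - thstar)
  + dotv (mean_field th - mean_field th') (th - thstar)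
  + dotv (g th' x - g th x) (th - thstar)
  + dotv (mean_field th') (th - th') - dotv (g th' x) (th - th').
  by rewrite !dotvE; ring.
have h1 := dotv_mean_field_lip (th - thstar) Cth Cth'.
have h2 := dotv_le_enorm (g th' x - g th x) (th - thstar).
have h3 := dotv_le_enorm (mean_field th') (th - th').
have h4 := norm_dotv_le (g th' x) (th - th').
have e0 := enorm_ge0 (th - th').
have h5 := star_dist_le Cth.
have h6 : G * enorm (th - th') * enorm (th - thstar) <= G * enorm (th - th') * (2 * C1).
  by rewrite ler_wpM2l// mulr_ge0// ltW.
have h7 : enorm (g th' x - g th x) * enorm (th - thstar) <=
    G * enorm (th - th') * enorm (th - thstar).
  by rewrite ler_wpM2r ?enorm_ge0// enormBC g_lip.
have h8 : enorm (mean_field th') * enorm (th - th') <= C0 * enorm (th - th').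
  by rewrite ler_wpM2r.
have h9 : enorm (g th' x) * enorm (th - th') <= C0 * enorm (th - th').
  by rewrite ler_wpM2r.
move: h4; rewrite ler_norml => /andP[h4 _].
lra.
Qed.

End GradientNoise.

(** * One projected step: progress and displacement *)

Section ProjectedGradient.
Set Implicit Arguments. Unset Strict Implicit. Unset Printing Implicit Defensive.
Context (R : realType) (d : nat).
Variables (C : set 'rV[R]_d) (proj : 'rV[R]_d -> 'rV[R]_d).
Hypotheses (cvxC : Defs.convex_set C) (projC : is_projection C proj).

Lemma projected_step_le th c h (eta C0 : R) : C c -> 0 < eta -> enorm h <= C0 ->
  dotv h (th - c) <=
  (enorm (th - c) ^+ 2 - enorm (proj (th - eta *: h) - c) ^+ 2) / (2 * eta)
  + eta * C0 ^+ 2 / 2.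
Proof.
move=> Cc eta0 hC0.
have := projection_dist_le (th - eta *: h) cvxC projC Cc.
rewrite -(@ler_pXn2r _ 2) ?nnegrE ?enorm_ge0//.
rewrite [X in _ <= X -> _]sqr_enorm (_ : th - eta *: h - c = th - c - eta *: h); last first.
  by rewrite addrAC.
move: (th - c) => u.
rewrite !dotvE (dotvC u h) -!sqr_enorm => DE.
have : enorm h ^+ 2 <= C0 ^+ 2.
  by rewrite ler_pXn2r ?nnegrE ?enorm_ge0// (le_trans (enorm_ge0 h)).
move=> /(ler_wpM2l (ltW eta0))/(ler_wpM2l (ltW eta0)) hh.
rewrite -(ler_pM2r (mulr_gt0 (ltr0n R 2) eta0)) [leRHS]mulrDl divfK; last first.
  by rewrite mulf_neq0// gt_eqF.
lra.
Qed.

(** Since [th] lies in [C], the projection can be compared with [th] itself. *)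
Lemma projected_step_dist th h (eta C0 : R) : C th -> 0 < eta -> enorm h <= C0 ->
  enorm (proj (th - eta *: h) - th) <= C0 * eta.
Proof.
move=> Cth eta0 hC0.
apply: (le_trans (projection_dist_le _ cvxC projC Cth)).
by rewrite addrC addKr enormN enormZ ?(ltW eta0)// mulrC ler_wpM2r// ltW.
Qed.

End ProjectedGradient.

(** * Noise along the trajectory and the expected loss of the averaged iterate *)

Section Descent.
Set Implicit Arguments. Unset Strict Implicit. Unset Printing Implicit Defensive.
Context (R : realType) (d : nat) (dO dZ : measure_display)
  (Omega : measurableType dO) (Z : measurableType dZ).
Variables (P : probability Omega R) (F : nat -> set (set Omega))
  (z : nat -> Omega -> Z) (Q : Z -> probability Z R) (mu : probability Z R)
  (tau : nat) (g : 'rV[R]_d -> Z -> 'rV[R]_d)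
  (ghat : nat -> Omega -> 'rV[R]_d -> Z -> 'rV[R]_d)
  (e : nat -> Omega -> R) (C : set 'rV[R]_d) (proj : 'rV[R]_d -> 'rV[R]_d)
  (C0 C1 G : R) (l : 'rV[R]_d -> R) (thstar : 'rV[R]_d)
  (eta : nat -> R) (theta : nat -> Omega -> 'rV[R]_d).
Hypotheses (filF : filtration F) (chain : markov_chain P F z Q)
  (statmu : stationary Q mu)
  (mix : mixing_time_bound Q mu tau)
  (mg : forall th i, measurable_fun setT (fun x => (g th x) ord0 i))
  (me : forall t, measurable_fun setT (e t))
  (e_sqr : forall t, (\int[P]_w ((e t w) ^+ 2)%:E < +oo)%E)
  (e_ge : forall t w, enorm (g (theta t w) (z t w) - ghat t w (theta t w) (z t w))
               <= e t w)
  (cvxC : Defs.convex_set C) (projC : is_projection C proj) (C_star : C thstar)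
  (C0_gt0 : 0 < C0) (C1_gt0 : 0 < C1) (G_gt0 : 0 < G)
  (mean_le : forall th, enorm (mean_field mu g th) <= C0)
  (ghat_le : forall t w th x, enorm (ghat t w th x) <= C0)
  (g_le : forall th x, enorm (g th x) <= C0)
  (C_le : forall th, C th -> enorm th <= C1)
  (g_lip : forall x th th', C th -> C th' ->
     enorm (g th x - g th' x) <= G * enorm (th - th'))
  (cvxl : convex_fun l) (gradl : gradient_of l (mean_field mu g))
  (eta_gt0 : forall t, 0 < eta t) (eta_noninc : forall t, eta t.+1 <= eta t)
  (C_theta0 : forall w, C (theta 0%N w))
  (thetaS : forall t w, theta t.+1 w =
       proj (theta t w - eta t *: ghat t w (theta t w) (z t w)))
  (theta_adapted : forall t i B, measurable B ->
     F t ((fun w => (theta t w) ord0 i) @^-1` B)).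

Let L := 4 * G * C1 + 2 * C0.
Let noise t w := grad_noise mu g thstar (theta t w) (z t w).

Lemma theta_in t w : C (theta t w).
Proof.
case: t => // t; rewrite thetaS.
by have [] := projC (theta t w - eta t *: ghat t w (theta t w) (z t w)).
Qed.

Lemma eta_add_le s n : eta (s + n) <= eta s.
Proof.
elim: n => [|n ih]; first by rewrite addn0.
by rewrite addnS (le_trans (eta_noninc _)).
Qed.

Lemma theta_drift s n w :
  enorm (theta (s + n) w - theta s w) <= C0 * (n%:R * eta s).
Proof.
elim: n => [|n ih].
  by rewrite addn0 subrr mul0r mulr0 -(scale0r (0 : 'rV[R]_d)) enormZ// mul0r.
rewrite addnS (le_trans (enormB_le _ (theta (s + n) w) _))//.
rewrite -natr1 mulrDl mul1r mulrDr addrC lerD//.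
rewrite thetaS (le_trans (projected_step_dist cvxC projC (theta_in _ _) (eta_gt0 _) (ghat_le _ _ _ _)))//.
by rewrite ler_wpM2l ?(ltW C0_gt0)// eta_add_le.
Qed.

Lemma L_ge0 : 0 <= L.
Proof. by rewrite addr_ge0 ?mulr_ge0// ltW. Qed.

(* The iterate [theta s] is replaced by a finitely valued approximation, so
   that no joint measurability of [g] is needed and [chain_decay] applies to
   each of its values. *)
Lemma noise_far s k : (1 <= k * tau)%N ->
  exists W : Omega -> R, [/\ bmeas W,
    forall w, noise (s + k * tau) w <= W w &
    \int[P]_w W w <= 2 * L * C0 * (k * tau)%:R * eta s + 8 * C0 * C1 / 2 ^+ k].
Proof.
set h := (k * tau)%N => h1.
(* The accuracy equals the bound on one step's displacement, so with [1 <= h] the discretization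
   error at most doubles the drift over [h] steps. *)
have eps0 : 0 < C0 * eta s by rewrite mulr_gt0.
have [sF _] := filF s.
have [I [c [rep [Fc Crep crep]]]] := finite_discretization sF C_star C_le
  (theta_in s) (theta_adapted s) eps0.
have [mQ _] := chain.
pose f i := grad_noise mu g thstar (rep i).
have bf i : bmeas (f i) by apply: (bmeas_grad_noise mu thstar mg g_le).
have bc i := @bmeas_indic R _ _ _ (filtration_measurable filF (Fc i)).
pose V i w := \1_(c @^-1` [set i]) w * f i (z (s + h) w).
have bV i : bmeas (V i) by apply: bmeasM => //; exact: (bmeas_chain filF chain).
pose K := L * (C0 * (h%:R * eta s) + C0 * eta s).
have pick (H : I -> R) w : \sum_i \1_(c @^-1` [set i]) w * H i = H (c w).
  rewrite (bigD1 (c w))//= big1 => [|i ic]; rewrite indicE.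
    by rewrite mem_set// mul1r addr0.
  by rewrite memNset ?mul0r//= => /esym/eqP; rewrite (negbTE ic).
have bVs : bmeas (fun w => \sum_i V i w) by exact: bmeas_sum.
exists (fun w => \sum_i V i w + K); split.
- exact: (bmeasD bVs (bmeas_cst _ K)).
- move=> w; rewrite pick (le_trans (grad_noise_lip mg G_gt0 mean_le g_le
    C_le C_star g_lip (z _ w) (theta_in _ _) (Crep (c w))))// lerD2l ler_wpM2l ?L_ge0//.
  by rewrite (le_trans (enormB_le _ (theta s w) _))// lerD// theta_drift.
rewrite RintegralD//; last 2 first.
- exact: bmeas_integrable.
- exact/bmeas_integrable/bmeas_cst.
rewrite Rintegral_const addrC lerD//.
  rewrite /K -mulrDr -[X in _ * (_ + X)]mul1r -mulrDl.
  rewrite (_ : 2 * L * C0 * h%:R * eta s = L * (C0 * ((h%:R + h%:R) * eta s))); last by ring.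
  rewrite ler_wpM2l ?L_ge0// ler_wpM2l ?(ltW C0_gt0)// ler_wpM2r ?(ltW (eta_gt0 _))//.
  by rewrite lerD2l ler1n.
have [_ ->] := Rintegral_sum (index_enum I) (fun i => bmeas_integrable P (bV i)).
apply: (@le_trans _ _ (\sum_i 2 * (4 * C0 * C1) / 2 ^+ k * \int[P]_w \1_(c @^-1` [set i]) w)).
  apply: ler_sum => i _.
  rewrite Rintegral_indic; last exact: (filtration_measurable filF (Fc i)).
  rewrite /V; apply: (chain_decay filF chain k statmu mix) => //.
  - by rewrite !mulr_gt0.
  - by move=> x; apply: (norm_grad_noise_le mean_le g_le C_le C_star).
  - exact: (Rintegral_grad_noise mu thstar mg g_le).
rewrite -mulr_sumr.
have [_ <-] := Rintegral_sum (index_enum I) (fun i => bmeas_integrable P (bc i)).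
rewrite (_ : \int[P]_w _ = 1) ?mulr1; first by rewrite !mulrA -natrM.
rewrite -[RHS](Rintegral_const P); apply: eq_Rintegral => w _.
by rewrite -[RHS](pick (fun=> 1) w); apply: eq_bigr => i _; rewrite mulr1.
Qed.

(** Before time [k * tau] there is no earlier iterate to freeze, so the uniform bound is used. The
    majorant [W] gives a measurable function to integrate in place of the noise. *)
Lemma noise_bound k t : (1 <= k * tau)%N ->
  exists W : Omega -> R, [/\ bmeas W, forall w, noise t w <= W w &
    \int[P]_w W w <= 4 * C0 * C1 * (t < k * tau)%N%:R
      + 2 * L * C0 * (k * tau)%:R * (if (t < k * tau)%N then 0 else eta (t - k * tau))
      + 8 * C0 * C1 / 2 ^+ k].
Proof.
move=> h1; have c0 : 0 <= 8 * C0 * C1 / 2 ^+ k.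
  by rewrite divr_ge0 ?exprn_ge0// !mulr_ge0// ltW.
case: ltnP => th; last first.
  have [W [bW nW iW]] := noise_far (t - k * tau) h1.
  by exists W; split=> //; [move: nW; rewrite subnK|rewrite mulr0 add0r].
exists (cst (4 * C0 * C1)); split; first exact: bmeas_cst.
- move=> w; rewrite (le_trans (ler_norm _))//.
  exact: (norm_grad_noise_le mean_le g_le C_le C_star _ (theta_in _ _)).
- by rewrite Rintegral_const mulr0 addr0 mulr1 lerDl.
Qed.

Let D t w := enorm (theta t w - thstar) ^+ 2.

Lemma D_le t w : 0 <= D t w <= 4 * C1 ^+ 2.
Proof.
rewrite sqr_ge0/= (_ : 4 * C1 ^+ 2 = (2 * C1) ^+ 2); last by ring.
rewrite ler_pXn2r ?nnegrE ?enorm_ge0 ?mulr_ge0 ?(ltW C1_gt0)//.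
exact: (star_dist_le C_le C_star (theta_in t w)).
Qed.

Lemma e_ge0 t w : 0 <= e t w.
Proof. exact: le_trans (enorm_ge0 _) (e_ge t w). Qed.

(** The mean gradient is split as [(gbar - g) + (g - ghat) + ghat] and paired with
    [theta t - thstar]: noise, approximation error [e t], and the telescoping projected step. *)
Lemma loss_step t w :
  l (theta t w) - l thstar <= (D t w - D t.+1 w) / (2 * eta t)
    + eta t * C0 ^+ 2 / 2 + 2 * C1 * e t w + noise t w.
Proof.
have hg := convex_gradient_le (theta t w) thstar cvxl gradl.
have := projected_step_le cvxC projC (theta t w) C_star (eta_gt0 t)
  (ghat_le t w (theta t w) (z t w)).
rewrite -thetaS -!/(D _ _) => hs.
have hd : dotv (g (theta t w) (z t w) - ghat t w (theta t w) (z t w))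
    (theta t w - thstar) <= 2 * C1 * e t w.
  rewrite (le_trans (dotv_le_enorm _ _))// mulrC ler_pM ?enorm_ge0//.
  exact: (star_dist_le C_le C_star (theta_in t w)).
have : noise t w + dotv (g (theta t w) (z t w) - ghat t w (theta t w) (z t w))
    (theta t w - thstar) + dotv (ghat t w (theta t w) (z t w)) (theta t w - thstar)
  = - dotv (mean_field mu g (theta t w)) (thstar - theta t w).
  by rewrite /noise /grad_noise !dotvE; ring.
lra.
Qed.

(** Jensen's inequality: in the gradient inequalities based at the average, the linear terms sum to
    zero. *)
Lemma avg_loss_le T w : (0 < T)%N -> T%:R * (l (avg_iter theta T w) - l thstar) <=
  \sum_(1 <= t < T.+1) (l (theta t w) - l thstar).
Proof.
move=> T0; set a := avg_iter theta T w.
have Tn : T%:R != 0 :> R by rewrite pnatr_eq0 -lt0n.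
have step t : l a - l thstar + dotv (mean_field mu g a) (theta t w - a)
    <= l (theta t w) - l thstar.
  by have := convex_gradient_le a (theta t w) cvxl gradl; lra.
apply: le_trans (ler_sum _ (fun t _ => step t)).
rewrite big_split/= sumr_const_nat subn1/= mulr_natl -dotv_sumr sumrB sumr_const_nat subn1/=.
rewrite -(scaler_nat T a) /a /avg_iter scalerA divff// scale1r subrr.
by rewrite dotvC dotv0l addr0.
Qed.

Lemma expect_avg_loss_le k T : (1 <= k * tau)%N -> (0 < T)%N ->
  (expect P (fun w => l (avg_iter theta T w)) <=
   (l thstar + T%:R^-1 * (2 * C1 ^+ 2 / eta T + C0 ^+ 2 / 2 * \sum_(t < T.+1) eta t
     + 2 * C1 * \sum_(t < T.+1) \int[P]_w e t w
     + 4 * C0 * C1 * (minn (k * tau) T.+1)%:R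
     + 2 * L * C0 * (k * tau)%:R * \sum_(t < T.+1) eta t
     + T.+1%:R * (8 * C0 * C1 / 2 ^+ k)))%:E)%E.
Proof.
move=> h1 T0; have [W /all_and3[bW nW iW]] := choice (fun t => noise_bound t h1).
have Tp : 0 < T%:R :> R by rewrite ltr0n.
have ie t : P.-integrable setT (EFin \o e t) by exact: integrable_of_sqr.
pose A : R := 2 * C1 ^+ 2 / eta T + C0 ^+ 2 / 2 * \sum_(t < T.+1) eta t.
pose U t w := 2 * C1 * e t w + W t w.
have iU t : P.-integrable setT (EFin \o U t).
  exact: (@integrableD _ _ _ P setT measurableT _ _
    (@integrableZl _ _ _ P setT measurableT (2 * C1) _ (ie t)) (bmeas_integrable P (bW t))).
have [iS eS] := Rintegral_sum (index_iota 1 T.+1) iU.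
have iZ : P.-integrable setT (EFin \o (fun w => T%:R^-1 * \sum_(1 <= t < T.+1) U t w)).
  exact: (@integrableZl _ _ _ P setT measurableT T%:R^-1 _ iS).
have iA : P.-integrable setT (EFin \o cst (l thstar + T%:R^-1 * A)).
  exact/bmeas_integrable/bmeas_cst.
(* An integrable pointwise majorant of the loss; expectations are then compared by monotonicity
   alone. *)
pose H w := l thstar + T%:R^-1 * A + T%:R^-1 * \sum_(1 <= t < T.+1) U t w.
have iH : P.-integrable setT (EFin \o H).
  exact: (@integrableD _ _ _ P setT measurableT _ _ iA iZ).
have lH w : l (avg_iter theta T w) <= H w.
  rewrite /H -addrA -mulrDr -lerBlDl ler_pdivlMl//.
  apply: (le_trans (avg_loss_le w T0)).
  apply: (@le_trans _ _ (\sum_(1 <= t < T.+1) ((D t w - D t.+1 w) / (2 * eta t)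
     + C0 ^+ 2 / 2 * eta t + U t w))).
    by apply: ler_sum => t _; have := loss_step t w; have := nW t w; rewrite /U; lra.
  rewrite !big_split/= lerD2r lerD//.
    rewrite (_ : 2 * C1 ^+ 2 / eta T = 4 * C1 ^+ 2 / (2 * eta T)); last first.
      by field; rewrite gt_eqF.
    exact: (abel_le T eta_gt0 eta_noninc (fun t => D_le t w)).
  rewrite -mulr_sumr ler_wpM2l ?divr_ge0 ?sqr_ge0//.
  by apply: sum_from1_le => t; exact: ltW.
apply: (@le_trans _ _ (\int[P]_w H w)%:E).
  rewrite [leRHS]fineK; last exact: (integrable_fin_num measurableT iH).
  by apply: le_integral_pointwise => w; rewrite lee_fin.
rewrite lee_fin /H RintegralD// RintegralZl// Rintegral_const eS.
rewrite -addrA lerD2l -mulrDr ler_pM2l ?invr_gt0// /A -![in leRHS]addrA -addrA lerD2l.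
have eE t : \int[P]_w U t w <= 2 * C1 * \int[P]_w e t w +
   (4 * C0 * C1 * (t < k * tau)%N%:R
      + 2 * L * C0 * (k * tau)%:R * (if (t < k * tau)%N then 0 else eta (t - k * tau))
      + 8 * C0 * C1 / 2 ^+ k).
  rewrite RintegralD//; last 2 first.
  - exact: (@integrableZl _ _ _ P setT measurableT (2 * C1) _ (ie t)).
  - exact: bmeas_integrable.
  by rewrite RintegralZl// lerD2l.
rewrite lerD2l (le_trans (ler_sum _ (fun t _ => eE t)))//.
apply: (le_trans (@sum_from1_le _ _ T _)) => [t|].
  rewrite !addr_ge0 ?mulr_ge0 ?invr_ge0 ?exprn_ge0 ?ler0n ?L_ge0 ?(ltW C1_gt0) ?(ltW C0_gt0)//.
    by apply: Rintegral_ge0 => w _; exact: e_ge0.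
  by case: ifP => // _; exact: ltW.
rewrite !big_split/= -!mulr_sumr lerD2l -!addrA lerD//.
  by rewrite ler_wpM2l ?mulr_ge0 ?(ltW C1_gt0) ?(ltW C0_gt0)// -natr_sum ler_nat sum_lt_le.
rewrite lerD//.
  by rewrite ler_wpM2l ?sum_shift_le// !mulr_ge0 ?L_ge0// ltW.
by rewrite sumr_const card_ord -(mulr_natl (2 ^- k)) mulrCA.
Qed.
End Descent.

(** * Choice of the block count and the final rates *)

Section Rate.
Set Implicit Arguments. Unset Strict Implicit. Unset Printing Implicit Defensive.
Context (R : realType).

(** Here [a] stands for [tau * ln T], [S] for the sum of step sizes, [h] for [k * tau], [mn] for its
    minimum with [T + 1], and [q] for [(T + 1) / 2 ^ k]. The quantity [1 + C0 + C1 + G] is at least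
    1 and dominates each constant, so its cube bounds every product of up to three of them. *)
Lemma rate_arith (C0 C1 G a S eta E h mn T q : R) :
  0 < C0 -> 0 < C1 -> 0 < G -> 0 < eta -> 2 <= T -> 2^-1 <= a -> T * eta <= S ->
  0 <= E -> h <= 4 * a -> mn <= h -> mn <= T + 1 -> q <= 2 ->
  2 * C1 ^+ 2 / eta + C0 ^+ 2 / 2 * S + 2 * C1 * E + 4 * C0 * C1 * mn
    + 2 * (4 * G * C1 + 2 * C0) * C0 * h * S + 8 * C0 * C1 * q
  <= 100 * (1 + C0 + C1 + G) ^+ 3 * (a * S + eta^-1 + E).
Proof.
move=> C00 C10 G0 eta0 T2 a2 TS E0 ha mnh mnT q2.
set ie := eta^-1; have ie0 : 0 < ie by rewrite invr_gt0.
set M := 1 + C0 + C1 + G; set X := a * S + ie.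
have T0 : 0 <= T by lra.
have S0 : 0 <= S by rewrite (le_trans _ TS)// mulr_ge0// ltW.
have aX : Num.min a T <= X by apply: min_le_step => //; lra.
(* Since [X] is bounded below, terms of constant size, such as the one with [q], are absorbed. *)
have X2 : 1 <= 2 * X.
  have : 2^-1 <= Num.min a T by rewrite le_min a2/=; lra.
  lra.
have mnX : mn <= 4 * X.
  have : mn / 4 <= Num.min a T by rewrite le_min; apply/andP; split; lra.
  lra.
have aS2 : S <= 2 * (a * S).
  by have := ler_wpM2r S0 a2; lra.
have hS : h * S <= 4 * (a * S) by have := ler_wpM2r S0 ha; lra.
have M1 : 1 <= M by rewrite /M; lra.
have ME3 : M ^+ 3 = M * M * M by ring.
have M3 x y : 0 <= x <= M -> 0 <= y <= M -> x * y <= M ^+ 3.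
  move=> /andP[x0 xM] /andP[y0 yM]; rewrite -[x * y]mulr1 ME3.
  by rewrite ler_pM ?mulr_ge0// ler_pM.
have c0M : 0 <= C0 <= M by rewrite /M; lra.
have c1M : 0 <= C1 <= M by rewrite /M; lra.
have gM : 0 <= G <= M by rewrite /M; lra.
have h1 := M3 _ _ c1M c1M; have h2 := M3 _ _ c0M c0M; have h3 := M3 _ _ c0M c1M.
have h4 : G * C1 * C0 <= M ^+ 3.
  case/andP: c0M c1M gM => ? ? /andP[? ?] /andP[? ?].
  by rewrite ME3 ler_pM ?mulr_ge0// ler_pM.
have h5 : C1 <= M ^+ 3 by rewrite -[C1]mul1r; apply: M3 => //; rewrite ler01.
have X0 : 0 <= X by lra.
set L := 4 * G * C1 + 2 * C0.
have LC : L * C0 <= 6 * M ^+ 3 by rewrite /L; lra.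
have LC0 : 0 <= L * C0 by rewrite mulr_ge0 ?addr_ge0 ?mulr_ge0// ltW.
have t1 : 2 * C1 ^+ 2 * ie <= 2 * (M ^+ 3 * X).
  rewrite -mulrA ler_pM2l// expr2 ler_pM ?mulr_ge0 ?(ltW C10) ?(ltW ie0)//.
  by rewrite /X lerDr; lra.
have t2 : C0 ^+ 2 * S <= M ^+ 3 * (2 * X).
  by rewrite expr2 ler_pM ?mulr_ge0 ?(ltW C00)// /X; lra.
have t3 : 2 * C1 * E <= 2 * (M ^+ 3 * E).
  by rewrite -mulrA ler_pM2l// ler_wpM2r.
have c01 : 0 <= C0 * C1 by rewrite mulr_ge0// ltW.
have t4 : C0 * C1 * mn <= C0 * C1 * (4 * X) by rewrite ler_wpM2l.
have t4' : C0 * C1 * X <= M ^+ 3 * X by rewrite ler_wpM2r.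
have t5 : L * C0 * (h * S) <= L * C0 * (4 * X).
  by rewrite ler_wpM2l// (le_trans hS)//; rewrite /X; lra.
have t5' : L * C0 * X <= 6 * M ^+ 3 * X by rewrite ler_wpM2r.
have t6 : C0 * C1 * q <= C0 * C1 * (4 * X) by rewrite ler_wpM2l//; lra.
have ME : 0 <= M ^+ 3 * E by rewrite mulr_ge0// exprn_ge0//; lra.
have MX : 0 <= M ^+ 3 * X by rewrite mulr_ge0// exprn_ge0//; lra.
move: t1 t2 t3 t4 t4' t5 t5' t6 ME MX; clear; clearbody L X M ie; lra.
Qed.

Section Bound.
Context (d : nat) (dO dZ : measure_display)
  (Omega : measurableType dO) (Z : measurableType dZ).
Variables (P : probability Omega R) (F : nat -> set (set Omega))
  (z : nat -> Omega -> Z) (Q : Z -> probability Z R) (mu : probability Z R)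
  (tau : nat) (g : 'rV[R]_d -> Z -> 'rV[R]_d)
  (ghat : nat -> Omega -> 'rV[R]_d -> Z -> 'rV[R]_d)
  (e : nat -> Omega -> R) (C : set 'rV[R]_d) (proj : 'rV[R]_d -> 'rV[R]_d)
  (C0 C1 G : R) (l : 'rV[R]_d -> R) (thstar : 'rV[R]_d)
  (eta : nat -> R) (theta : nat -> Omega -> 'rV[R]_d).
Hypothesis setting :
  psgd_setting P F z Q mu tau g ghat e C proj C0 C1 G l thstar eta theta.

Lemma setting_consts : [/\ 0 < C0, 0 < C1 & 0 < G].
Proof. by move: setting; do 13! [case=> _]; case=> ? [? [? _]]; split. Qed.

Lemma expect_eE t : expect P (e t) = (\int[P]_w e t w)%:E.
Proof.
move: setting; do 6! [case=> _]; case=> me [e2 _].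
rewrite /expect fineK//; apply: (integrable_fin_num measurableT).
exact: (integrable_of_sqr (me t) (e2 t)).
Qed.

Lemma Rintegral_e_ge0 t : 0 <= \int[P]_w e t w.
Proof.
move: setting; do 8! [case=> _]; case=> eg _.
by apply: Rintegral_ge0 => w _; exact: le_trans (enorm_ge0 _) (eg t w).
Qed.

Lemma psgd_rate T : (2 <= T)%N ->
  (expect P (fun w => l (avg_iter theta T w)) - (l thstar)%:E <=
   (100 * (1 + C0 + C1 + G) ^+ 3 / T%:R *
     (tau%:R * ln T%:R * \sum_(t < T.+1) eta t + (eta T)^-1
      + \sum_(t < T.+1) \int[P]_w e t w))%:E)%E.
Proof.
move=> T2; have E0 : 0 <= \sum_(t < T.+1) \int[P]_w e t w.
  by apply: sumr_ge0 => t _; exact: Rintegral_e_ge0.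
move: setting => [filF [chain [st [tau1 [mix [mg [me [e2 [eg [clC [cvxC [projC
  [Cst [C00 [C10 [G0 [meanle [ghle [gle [Cle [glip [cvxl [gradl [lmin
  [eta0 [etaS [Cth0 [thS thF]]]]]]]]]]]]]]]]]]]]]]]]]]]].
have T0 : (0 < T)%N by lia.
have Tp : 0 < T%:R :> R by rewrite ltr0n.
(* The least [k] with [T <= 2 ^ k]: the residual correlations, summed over [T + 1] times, stay
   bounded, while [k] is still of order [ln T]. *)
pose k := up_log 2 T.
have k1 : (1 <= k)%N by rewrite /k up_log_gt0; lia.
have ktau : (1 <= k * tau)%N by rewrite muln_gt0 k1.
have Tk : (T <= 2 ^ k)%N by exact: up_logP.
rewrite leeBlDr//.
apply: (le_trans (expect_avg_loss_le filF chain st mix mg me e2 eg cvxC projC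
  Cst C00 C10 G0 meanle ghle gle Cle glip cvxl gradl eta0 etaS Cth0 thS thF ktau T0)).
rewrite -EFinD lee_fin [leRHS]addrC lerD2l.
rewrite [leRHS](_ : _ = T%:R^-1 * (100 * (1 + C0 + C1 + G) ^+ 3 *
  (tau%:R * ln T%:R * \sum_(t < T.+1) eta t + (eta T)^-1
      + \sum_(t < T.+1) \int[P]_w e t w))); last by rewrite [RHS]mulrC mulrAC.
rewrite ler_pM2l ?invr_gt0//.
rewrite (_ : T.+1%:R * _ = 8 * C0 * C1 * (T.+1%:R / 2 ^+ k)); last by rewrite mulrCA.
have lnT := ln_ge_half R T2.
apply: (rate_arith (T := T%:R)) => //.
- by rewrite ler_nat.
- rewrite -[leLHS]mul1r; apply: ler_pM => //; first by rewrite ler1n.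
- have : \sum_(t < T.+1) eta T <= \sum_(t < T.+1) eta t.
    apply: ler_sum => t _; have tT : (t <= T)%N by rewrite -ltnS.
    by rewrite -{1}(subnKC tT) (eta_add_le etaS).
  rewrite sumr_const card_ord -(mulr_natl (eta T)); apply: le_trans.
  by rewrite ler_wpM2r ?(ltW (eta0 _))// ler_nat.
- by rewrite [leRHS]mulrCA [leRHS]mulrC natrM ler_wpM2r// up_log2_le.
- by rewrite ler_nat geq_minl.
- by rewrite natr1 ler_nat geq_minr.
- rewrite ler_pdivrMr ?exprn_gt0// -natrX -natrM ler_nat; lia.
Qed.

(** At [t = 0], where [1 / sqrt t] is meaningless, the step size is [eta0] and the error [e 0]
    enters through its own expectation [E0]. All remaining sums are of order [sqrt T]. *)
Lemma psgd_rate_sqrt (eta0 M : R) : 0 < eta0 ->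
  (forall t, eta t = eta0 / Num.sqrt (maxn t 1)%:R) ->
  (forall t, (1 <= t)%N -> \int[P]_w e t w <= M / Num.sqrt t%:R) ->
  exists Cst : R, forall T : nat, (2 <= T)%N ->
    (expect P (fun w => l (avg_iter theta T w)) - (l thstar)%:E <=
     (Cst * ln T%:R / Num.sqrt T%:R)%:E)%E.
Proof.
move=> eta00 etaE eM; have [C00 C10 G0] := setting_consts.
pose K : R := 100 * (1 + C0 + C1 + G) ^+ 3.
pose E0 := \int[P]_w e 0%N w.
have K0 : 0 <= K by rewrite mulr_ge0// exprn_ge0// !addr_ge0// ltW.
have M0 : 0 <= M.
  have := eM 1%N isT; rewrite sqrtr1 divr1; apply: le_trans.
  exact: Rintegral_e_ge0.
(* The 3 collects the initial step and the sum of the others, [eta0 + 2 * eta0 * s <= 3 * eta0 * s];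
   the outer factors 2 come from [1 <= 2 * ln T], which supplies the logarithm where it is
   missing. *)
exists (K * (3 * (tau%:R * eta0) + 2 / eta0 + 2 * (E0 + 2 * M))) => T T2.
apply: (le_trans (psgd_rate T2)); rewrite lee_fin -/K.
have lnT := ln_ge_half R T2.
set s := Num.sqrt T%:R.
have s1 : 1 <= s by rewrite -sqrtr1 ler_wsqrtr// ler1n; lia.
have s0 : 0 < s by lra.
have sT : s * s = T%:R by rewrite -expr2 sqr_sqrtr.
have sum_split (x : nat -> R) : \sum_(t < T.+1) x t = x 0%N + \sum_(1 <= t < T.+1) x t.
  by rewrite -(big_mkord xpredT x) big_ltn.
have sumS : \sum_(1 <= t < T.+1) (Num.sqrt t%:R)^-1 <= 2 * s :> R by exact: sum_inv_sqrt_le.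
have etaS : \sum_(t < T.+1) eta t <= 3 * (eta0 * s).
  rewrite sum_split etaE max0n sqrtr1 divr1.
  rewrite (eq_big_nat _ _ (F2 := fun t => eta0 * (Num.sqrt t%:R)^-1)); last first.
    by move=> t /andP[t1 _]; rewrite etaE (maxn_idPl t1).
  rewrite -mulr_sumr.
  have := ler_wpM2l (ltW eta00) sumS; have := ler_wpM2l (ltW eta00) s1; lra.
have eS : \sum_(t < T.+1) \int[P]_w e t w <= E0 + 2 * (M * s).
  rewrite (sum_split (fun t => \int[P]_w e t w)) lerD2l.
  apply: (@le_trans _ _ (\sum_(1 <= t < T.+1) M * (Num.sqrt t%:R)^-1)).
    by apply: ler_sum_nat => t /andP[t1 _]; exact: eM.
  by rewrite -mulr_sumr mulrCA ler_wpM2l.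
have etaT : (eta T)^-1 = s / eta0.
  have T1 : (1 <= T)%N by exact: ltnW.
  by rewrite etaE (maxn_idPl T1) invf_div.
rewrite etaT.
set u := ln T%:R in lnT *.
rewrite (_ : _ / s = K / T%:R * ((3 * (tau%:R * eta0) + 2 / eta0 + 2 * (E0 + 2 * M)) * (u * s))); last first.
  by rewrite -sT; field; rewrite !gt_eqF.
rewrite ler_wpM2l ?divr_ge0//.
set t0 := tau%:R * eta0.
have ls : 2^-1 <= u * s by rewrite -[leLHS]mulr1 ler_pM// invr_ge0.
have h1 : tau%:R * u * \sum_(t < T.+1) eta t <= 3 * (t0 * (u * s)).
  rewrite (_ : 3 * _ = tau%:R * u * (3 * (eta0 * s))); last by rewrite /t0; ring.
  by rewrite ler_wpM2l// mulr_ge0//; lra.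
have h2 : s / eta0 <= 2 * ((u * s) / eta0).
  rewrite mulrA ler_pM2r ?invr_gt0//.
  by have := ler_wpM2r (ltW s0) lnT; lra.
have E00 : 0 <= E0 by exact: Rintegral_e_ge0.
have h3 : E0 <= 2 * (E0 * (u * s)) by have := ler_wpM2l E00 ls; lra.
have h4 : M * s <= 2 * (M * (u * s)).
  have := ler_wpM2l M0 (ler_wpM2r (ltW s0) lnT); lra.
lra.
Qed.
End Bound.
End Rate.

Theorem theorem1 (R : realType) :
  (exists (c : R) (n : nat), 0 < c /\
    forall (d : nat) (dO dZ : measure_display)
      (Omega : measurableType dO) (Z : measurableType dZ)
      (P : probability Omega R) (F : nat -> set (set Omega))
      (z : nat -> Omega -> Z) (Q : Z -> probability Z R) (mu : probability Z R)
      (tau : nat) (g : 'rV[R]_d -> Z -> 'rV[R]_d)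
      (ghat : nat -> Omega -> 'rV[R]_d -> Z -> 'rV[R]_d)
      (e : nat -> Omega -> R) (C : set 'rV[R]_d) (proj : 'rV[R]_d -> 'rV[R]_d)
      (C0 C1 G : R) (l : 'rV[R]_d -> R) (thstar : 'rV[R]_d)
      (eta : nat -> R) (theta : nat -> Omega -> 'rV[R]_d),
    psgd_setting P F z Q mu tau g ghat e C proj C0 C1 G l thstar eta theta ->
    let K := c * (1 + C0 + C1 + G) ^+ n in
    forall T : nat, (2 <= T)%N ->
      (expect P (fun w => l (avg_iter theta T w)) - (l thstar)%:E <=
       (K / T%:R)%:E *
       ((tau%:R * ln T%:R * \sum_(t < T.+1) eta t + (eta T)^-1)%:E
        + \sum_(t < T.+1) expect P (e t)))%E)
  /\
  (forall (d : nat) (dO dZ : measure_display)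
      (Omega : measurableType dO) (Z : measurableType dZ)
      (P : probability Omega R) (F : nat -> set (set Omega))
      (z : nat -> Omega -> Z) (Q : Z -> probability Z R) (mu : probability Z R)
      (tau : nat) (g : 'rV[R]_d -> Z -> 'rV[R]_d)
      (ghat : nat -> Omega -> 'rV[R]_d -> Z -> 'rV[R]_d)
      (e : nat -> Omega -> R) (C : set 'rV[R]_d) (proj : 'rV[R]_d -> 'rV[R]_d)
      (C0 C1 G : R) (l : 'rV[R]_d -> R) (thstar : 'rV[R]_d)
      (eta : nat -> R) (theta : nat -> Omega -> 'rV[R]_d) (eta0 M : R),
    psgd_setting P F z Q mu tau g ghat e C proj C0 C1 G l thstar eta theta ->
    0 < eta0 ->
    (forall t, eta t = eta0 / Num.sqrt (maxn t 1)%:R) ->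
    (forall t, (1 <= t)%N -> (expect P (e t) <= (M / Num.sqrt t%:R)%:E)%E) ->
    exists Cst : R, forall T : nat, (2 <= T)%N ->
      (expect P (fun w => l (avg_iter theta T w)) - (l thstar)%:E <=
       (Cst * ln T%:R / Num.sqrt T%:R)%:E)%E).
Proof.
split.
  (* Both numbers come from [rate_arith] and are fixed before the dimension, the chain and the
     data. *)
  exists 100, 3%N; split=> // d dO dZ Omega Z P F z Q mu tau g ghat e C proj
    C0 C1 G l thstar eta theta setting K T T2.
  apply: (le_trans (psgd_rate setting T2)).
  rewrite (eq_bigr (fun t : 'I_T.+1 => (\int[P]_w e t w)%:E)) => [|t _].
    by rewrite sumEFin -EFinD -EFinM.
  exact: (expect_eE setting).
move=> d dO dZ Omega Z P F z Q mu tau g ghat e C proj C0 C1 G l thstar eta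
  theta eta0 M setting eta0_gt0 etaE eM.
apply: (psgd_rate_sqrt (M := M) setting eta0_gt0 etaE) => t t1.
by have := eM t t1; rewrite (expect_eE setting) lee_fin.
Qed.
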